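(* Let $G$ be a finite group. Then the set $\{\iota_G(f^G_J)\mid J\in \mathrm{C}^{\infty}(G)\}$ is the set of all primitive idempotents of the crossed Burnside ring $B^{\mathrm c}(G)$ (over $\mathbb{Z}$).
   Context: Crossed Burnside ring. $G^{\mathrm c}$ is the set $G$ with $G$ acting by conjugation. A crossed $G$-set $(X,\alpha)$ is a finite $G$-set $X$ with a $G$-map $\alpha:X\to G^{\mathrm c}$; morphisms are $G$-maps over $G^{\mathrm c}$. $B^{\mathrm c}(G)$ is the Grothendieck group of crossed $G$-sets with respect to disjoint union, a ring via $(X,\alpha)\cdot(Y,\beta)=(X\times Y,\ (x,y)\mapsto \alpha(x)\beta(y))$. For $H\le G$ and $a\in C_G(H)$, $[H,a]_G$ is the class of $(G/H,\ gH\mapsto gag^{-1})$; these classes, with $(H,a)$ taken up to $G$-conjugacy, form a $\mathbb{Z}$-basis. The identity element is $[G,\epsilon]_G$ with $\epsilon$ the identity of $G$. Burnside ring. $B(G)$ is the Burnside ring of $G$, with basis $[G/H]$, $H\in \mathrm{C}(G)$, where $\mathrm{C}(G)$ is a set of representatives of the conjugacy classes of subgroups of $G$. The ring monomorphism $\iota_G:B(G)\to B^{\mathrm c}(G)$ is $[G/U]\mapsto [U,\epsilon]_G$. Idempotents of $B(G)$. For $H\le G$, $e^G_H\in \mathbb{Q}\otimes B(G)$ is the primitive idempotent characterized by: the mark (number of $K$-fixed points, extended linearly) of $e^G_H$ at $K\le G$ is $1$ if $K$ is $G$-conjugate to $H$ and $0$ otherwise. $H^{\infty}$ is the smallest normal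 subgroup of $H$ with soluble quotient. $\mathrm{C}^{\infty}(G)$ is a set of representatives of the $G$-conjugacy classes of perfect subgroups of $G$. For $J\in\mathrm{C}^{\infty}(G)$, $$f^G_J=\sum_{H\in \mathrm{C}(G),\ H^{\infty}=_G J} e^G_H ,$$ where $=_G$ means $G$-conjugate. By Dress's theorem these elements lie in $B(G)$ and are exactly the primitive idempotents of $B(G)$. *)

(* Defs.v *)
From HB Require Import structures.
From mathcomp Require Import all_boot all_fingroup all_solvable all_algebra.
From mathcomp Require Import generic_quotient ring boolp.
From mathcomp Require classical_sets.

Set Implicit Arguments.
Unset Strict Implicit.
Unset Printing Implicit Defensive.

Import GroupScope GRing.Theory Num.Theory.
Local Open Scope ring_scope.
Local Open Scope quotient_scope.

Definition primitive_idempotent (R : pzRingType) (e : R) : Prop :=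
  [/\ e * e = e, e <> 0 &
      forall a b : R, a * a = a -> b * b = b -> a * b = 0 -> b * a = 0 ->
        e = a + b -> a = 0 \/ b = 0].

(* The Grothendieck ring of a commutative semiring: the pair (a, b) stands   *)
(* for the formal difference a - b.                                          *)
Section Grothendieck.
Variable S : comPzSemiRingType.

Definition groth_rel (x y : S * S) : bool :=
  `[< exists z, x.1 + y.2 + z = y.1 + x.2 + z >].

Lemma groth_rel_refl : reflexive groth_rel.
Proof. by move=> x; apply/asboolP; exists 0. Qed.

Lemma groth_rel_sym : symmetric groth_rel.
Proof. by move=> x y; apply/asboolP/asboolP => -[z e]; exists z. Qed.

Lemma groth_rel_trans : transitive groth_rel.
Proof.
move=> y x w /asboolP[z e] /asboolP[z' e']; apply/asboolP.
exists (y.1 + y.2 + z + z').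
transitivity ((x.1 + y.2 + z) + (y.1 + w.2 + z')); first by ring.
by rewrite e e'; ring.
Qed.

Canonical groth_equiv :=
  EquivRel groth_rel groth_rel_refl groth_rel_sym groth_rel_trans.

Definition groth := {eq_quot groth_equiv}.
HB.instance Definition _ := Choice.on groth.

Definition gdiff (a b : S) : groth := \pi_({eq_quot groth_equiv}) (a, b).
Definition gfst (x : groth) : S := (repr (x : {eq_quot groth_equiv})).1.
Definition gsnd (x : groth) : S := (repr (x : {eq_quot groth_equiv})).2.

Lemma gdiffK x : gdiff (gfst x) (gsnd x) = x.
Proof. by rewrite /gdiff /gfst /gsnd -surjective_pairing reprK. Qed.

Lemma gdiffP a b c d :
  gdiff a b = gdiff c d <-> exists z, a + d + z = c + b + z.
Proof. by split=> [/eqquotP/asboolP|h]; last by apply/eqquotP/asboolP. Qed.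

Lemma gdiff_repr a b :
  exists z, gfst (gdiff a b) + b + z = a + gsnd (gdiff a b) + z.
Proof. by apply/gdiffP; rewrite gdiffK. Qed.

Definition gadd x y := gdiff (gfst x + gfst y) (gsnd x + gsnd y).
Definition gopp x := gdiff (gsnd x) (gfst x).
Definition gmul x y := gdiff (gfst x * gfst y + gsnd x * gsnd y)
                             (gfst x * gsnd y + gsnd x * gfst y).

Lemma gaddE a b c d : gadd (gdiff a b) (gdiff c d) = gdiff (a + c) (b + d).
Proof.
rewrite /gadd; have [z] := gdiff_repr a b; have [z'] := gdiff_repr c d.
set a' := gfst (gdiff a b); set b' := gsnd (gdiff a b).
set c' := gfst (gdiff c d); set d' := gsnd (gdiff c d) => e' e.
apply/gdiffP; exists (z + z').
transitivity ((a' + b + z) + (c' + d + z')); first by ring.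
by rewrite e e'; ring.
Qed.

Lemma goppE a b : gopp (gdiff a b) = gdiff b a.
Proof.
rewrite /gopp; have [z] := gdiff_repr a b.
set a' := gfst _; set b' := gsnd _ => e.
by apply/gdiffP; exists z; rewrite addrC (addrC b') addrC -e (addrC b).
Qed.

Lemma gmulC : commutative gmul.
Proof. by move=> x y; rewrite /gmul; congr gdiff; ring. Qed.

Lemma gmulEl a b y :
  gmul (gdiff a b) y = gdiff (a * gfst y + b * gsnd y) (a * gsnd y + b * gfst y).
Proof.
rewrite /gmul; have [z] := gdiff_repr a b; set c := gfst y; set d := gsnd y.
set a' := gfst (gdiff a b); set b' := gsnd (gdiff a b) => e.
apply/gdiffP; exists (z * c + z * d).
transitivity ((a' + b + z) * c + (a + b' + z) * d); first by ring.
transitivity ((a + b' + z) * c + (a' + b + z) * d); last by ring.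
by rewrite e.
Qed.

Lemma gmulE a b c d :
  gmul (gdiff a b) (gdiff c d) = gdiff (a * c + b * d) (a * d + b * c).
Proof.
rewrite gmulEl; have [z] := gdiff_repr c d; set c' := gfst _; set d' := gsnd _ => e.
apply/gdiffP; exists (a * z + b * z).
transitivity (a * (c' + d + z) + b * (c + d' + z)); first by ring.
transitivity (a * (c + d' + z) + b * (c' + d + z)); last by ring.
by rewrite e.
Qed.

Lemma gaddA : associative gadd.
Proof.
move=> x y z; rewrite -(gdiffK x) -(gdiffK y) -(gdiffK z) !gaddE.
by rewrite !addrA.
Qed.

Lemma gaddC : commutative gadd.
Proof. by move=> x y; rewrite /gadd; congr gdiff; rewrite addrC. Qed.

Lemma gadd0 : left_id (gdiff 0 0) gadd.
Proof. by move=> x; rewrite -(gdiffK x) gaddE !add0r. Qed.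

Lemma gaddN : left_inverse (gdiff 0 0) gopp gadd.
Proof.
move=> x; rewrite -(gdiffK x) goppE gaddE.
by apply/gdiffP; exists 0; ring.
Qed.

HB.instance Definition _ := GRing.isZmodule.Build groth gaddA gaddC gadd0 gaddN.

Lemma gmulA : associative gmul.
Proof.
move=> x y z; rewrite -(gdiffK x) -(gdiffK y) -(gdiffK z) !gmulE.
by congr gdiff; ring.
Qed.

Lemma gmul1 : left_id (gdiff 1 0) gmul.
Proof. by move=> x; rewrite -(gdiffK x) gmulE; congr gdiff; ring. Qed.

Lemma gmulDl : left_distributive gmul +%R.
Proof.
move=> x y z; rewrite -(gdiffK x) -(gdiffK y) -(gdiffK z) -!/(gadd _ _).
rewrite [_ + _]gaddE !gmulE [RHS]gaddE.
by congr gdiff; ring.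
Qed.

HB.instance Definition _ :=
  GRing.Zmodule_isComPzRing.Build groth gmulA gmulC gmul1 gmulDl.

Lemma gdiffD a b c d : gdiff a b + gdiff c d = gdiff (a + c) (b + d).
Proof. exact: gaddE. Qed.

Lemma gdiffM a b c d :
  gdiff a b * gdiff c d = gdiff (a * c + b * d) (a * d + b * c).
Proof. exact: gmulE. Qed.

Lemma gdiffN a b : - gdiff a b = gdiff b a.
Proof. exact: goppE. Qed.

Definition groth_in (a : S) : groth := gdiff a 0.

Lemma gdiff_in a b : gdiff a b = groth_in a - groth_in b.
Proof. by rewrite gdiffN gdiffD addr0 add0r. Qed.

Definition groth_ext (A : zmodType) (f : S -> A) (x : groth) : A :=
  f (gfst x) - f (gsnd x).

Lemma groth_extE (A : zmodType) (f : S -> A) a b :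
  {morph f : u v / u + v} -> groth_ext f (gdiff a b) = f a - f b.
Proof.
move=> fD; rewrite /groth_ext; have [z] := gdiff_repr a b.
set a' := gfst _; set b' := gsnd _ => /(congr1 f); rewrite !fD => /addIr e.
by apply/eqP; rewrite subr_eq addrAC eq_sym subr_eq e.
Qed.

Lemma groth_ext_zmod_morphism (A : zmodType) (f : S -> A) :
  {morph f : u v / u + v} -> zmod_morphism (groth_ext f).
Proof.
move=> fD x y; rewrite -(gdiffK x) -(gdiffK y) gdiffN gdiffD !groth_extE // !fD.
by rewrite !opprD opprK addrACA; congr (_ + _); rewrite addrC.
Qed.

End Grothendieck.

(* Q (x) A for a commutative ring A, as the localisation of A at the         *)
(* positive integers; qfrac a n is a (x) 1/(n+1).                            *)
Section RationalTensor.
Variable A : comPzRingType.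

Definition qtens_rel (x y : A * nat) : bool :=
  `[< exists k, (x.1 *+ y.2.+1 - y.1 *+ x.2.+1) *+ k.+1 = 0 >].

Lemma qtens_rel_refl : reflexive qtens_rel.
Proof. by move=> x; apply/asboolP; exists 0%N; rewrite subrr. Qed.

Lemma qtens_rel_sym : symmetric qtens_rel.
Proof.
move=> x y; apply/asboolP/asboolP => -[k e]; exists k;
by rewrite -opprB mulNrn e oppr0.
Qed.

Lemma qtens_rel_trans : transitive qtens_rel.
Proof.
move=> [b m] [a n] [c p] /asboolP/=[k e] /asboolP/=[l e']; apply/asboolP => /=.
exists ((k.+1 * l.+1 * m.+1).-1); rewrite prednK ?muln_gt0 //.
transitivity ((a *+ m.+1 - b *+ n.+1) *+ k.+1 *+ (l.+1 * p.+1)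
  + (b *+ p.+1 - c *+ m.+1) *+ l.+1 *+ (k.+1 * n.+1)); last first.
  by rewrite e e' !mul0rn addr0.
by ring.
Qed.

Canonical qtens_equiv :=
  EquivRel qtens_rel qtens_rel_refl qtens_rel_sym qtens_rel_trans.

Definition qtens := {eq_quot qtens_equiv}.
HB.instance Definition _ := Choice.on qtens.

Definition qfrac (a : A) (n : nat) : qtens := \pi_({eq_quot qtens_equiv}) (a, n).
Definition qnum (x : qtens) : A := (repr (x : {eq_quot qtens_equiv})).1.
Definition qden (x : qtens) : nat := (repr (x : {eq_quot qtens_equiv})).2.

Lemma qfracK x : qfrac (qnum x) (qden x) = x.
Proof. by rewrite /qfrac /qnum /qden -surjective_pairing reprK. Qed.

Lemma qfracP a n b m :
  qfrac a n = qfrac b m <-> exists k, (a *+ m.+1 - b *+ n.+1) *+ k.+1 = 0.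
Proof. by split=> [/eqquotP/asboolP|h]; last by apply/eqquotP/asboolP. Qed.

Lemma qfrac_repr a n :
  exists k, (qnum (qfrac a n) *+ n.+1 - a *+ (qden (qfrac a n)).+1) *+ k.+1 = 0.
Proof. by apply/qfracP; rewrite qfracK. Qed.

Definition qadd x y := qfrac (qnum x *+ (qden y).+1 + qnum y *+ (qden x).+1)
                             ((qden x).+1 * (qden y).+1).-1.
Definition qopp x := qfrac (- qnum x) (qden x).
Definition qmul x y := qfrac (qnum x * qnum y) ((qden x).+1 * (qden y).+1).-1.

Lemma qaddC : commutative qadd.
Proof. by move=> x y; rewrite /qadd mulnC addrC. Qed.

Lemma qmulC : commutative qmul.
Proof. by move=> x y; rewrite /qmul mulnC mulrC. Qed.

Lemma qaddE a n b m :
  qadd (qfrac a n) (qfrac b m) = qfrac (a *+ m.+1 + b *+ n.+1) (n.+1 * m.+1).-1.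
Proof.
rewrite /qadd; have [k] := qfrac_repr a n; have [l] := qfrac_repr b m.
set a' := qnum (qfrac a n); set n' := qden (qfrac a n).
set b' := qnum (qfrac b m); set m' := qden (qfrac b m) => e' e.
apply/qfracP; exists (k.+1 * l.+1).-1; rewrite !prednK ?muln_gt0 //.
transitivity ((a' *+ n.+1 - a *+ n'.+1) *+ k.+1 *+ (l.+1 * m.+1 * m'.+1)
  + (b' *+ m.+1 - b *+ m'.+1) *+ l.+1 *+ (k.+1 * n.+1 * n'.+1)); last first.
  by rewrite e e' !mul0rn addr0.
by ring.
Qed.

Lemma qoppE a n : qopp (qfrac a n) = qfrac (- a) n.
Proof.
rewrite /qopp; have [k] := qfrac_repr a n.
set a' := qnum _; set n' := qden _ => e; apply/qfracP; exists k.
by rewrite !mulNrn -opprD mulNrn e oppr0.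
Qed.

Lemma qmulE a n b m :
  qmul (qfrac a n) (qfrac b m) = qfrac (a * b) (n.+1 * m.+1).-1.
Proof.
rewrite /qmul; have [k] := qfrac_repr a n; have [l] := qfrac_repr b m.
set a' := qnum (qfrac a n); set n' := qden (qfrac a n).
set b' := qnum (qfrac b m); set m' := qden (qfrac b m) => e' e.
apply/qfracP; exists (k.+1 * l.+1).-1; rewrite !prednK ?muln_gt0 //.
transitivity ((a' *+ n.+1 - a *+ n'.+1) *+ k.+1 * b' *+ (l.+1 * m.+1)
  + (b' *+ m.+1 - b *+ m'.+1) *+ l.+1 * a *+ (k.+1 * n'.+1)); last first.
  by rewrite e e' !mul0r !mul0rn addr0.
by ring.
Qed.

Lemma qaddA : associative qadd.
Proof.
move=> x y z; rewrite -(qfracK x) -(qfracK y) -(qfracK z) !qaddE.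
rewrite !prednK ?muln_gt0 // mulnA; congr qfrac.
by ring.
Qed.

Lemma qadd0 : left_id (qfrac 0 0) qadd.
Proof. by move=> x; rewrite -(qfracK x) qaddE mul0rn add0r mul1n. Qed.

Lemma qaddN : left_inverse (qfrac 0 0) qopp qadd.
Proof.
move=> x; rewrite -(qfracK x) qoppE qaddE mulNrn addNr.
by apply/qfracP; exists 0%N; rewrite !mul0rn subrr.
Qed.

HB.instance Definition _ := GRing.isZmodule.Build qtens qaddA qaddC qadd0 qaddN.

Lemma qmulA : associative qmul.
Proof.
move=> x y z; rewrite -(qfracK x) -(qfracK y) -(qfracK z) !qmulE.
by rewrite !prednK ?muln_gt0 // mulnA mulrA.
Qed.

Lemma qmul1 : left_id (qfrac 1 0) qmul.
Proof. by move=> x; rewrite -(qfracK x) qmulE mul1r mul1n. Qed.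

Lemma qmulDl : left_distributive qmul +%R.
Proof.
move=> x y z; rewrite -(qfracK x) -(qfracK y) -(qfracK z).
rewrite [_ + _]qaddE !qmulE [RHS]qaddE.
apply/qfracP; exists 0%N; rewrite !prednK ?muln_gt0 //.
by ring.
Qed.

HB.instance Definition _ :=
  GRing.Zmodule_isComPzRing.Build qtens qmulA qmulC qmul1 qmulDl.

(* The map a |-> 1 (x) a. *)
Definition qtens_in (a : A) : qtens := qfrac a 0.

Definition qtens_ext (f : A -> int) (x : qtens) : rat :=
  (f (qnum x))%:~R / (qden x).+1%:R.

Lemma qtens_extE (f : A -> int) a n :
  zmod_morphism f -> qtens_ext f (qfrac a n) = (f a)%:~R / n.+1%:R.
Proof.
move=> fB; pose m := GRing.isZmodMorphism.Build _ _ f fB.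
pose F : {additive A -> int} := HB.pack f m.
have f0 : f 0 = 0 := raddf0 F.
have fM x k : f (x *+ k) = f x *+ k := raddfMn F k x.
rewrite /qtens_ext; have [k] := qfrac_repr a n.
set a' := qnum _; set n' := qden _ => /(congr1 f).
rewrite fM fB !fM f0 => /eqP; rewrite mulrn_eq0 orFb subr_eq0.
move=> /eqP/(congr1 (fun z : int => z%:~R : rat)).
rewrite !rmorphMn -[in LHS]mulr_natr -[in RHS]mulr_natr => e.
by apply/eqP; rewrite eqr_div ?pnatr_eq0 //; apply/eqP.
Qed.

End RationalTensor.

(* G-sets are MathComp right actions of G; a left G-set is turned into one   *)
(* by x^g = g^-1 x, and the left conjugation action on G into x ^ g.         *)
Section GSets.
Variables (gT : finGroupType) (G : {group gT}).
Implicit Types (S T U V : finType) (H K : {group gT}).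

Definition equivariant S T (a : action G S) (b : action G T) (f : S -> T) :=
  forall x, {in G, forall g, f (a x g) = b (f x) g}.

Definition gset_iso S T (a : action G S) (b : action G T) :=
  exists2 f : S -> T, bijective f & equivariant a b f.

Lemma actI S (a : action G S) g x y : a x g = a y g -> x = y.
Proof. exact: act_inj. Qed.

Lemma sum_is_action S T (a : action G S) (b : action G T) :
  is_action G (fun (u : (S + T)%type) g =>
    match u with inl x => inl (a x g) | inr y => inr (b y g) end).
Proof.
split=> [g [x|x] [y|y] //= [/actI->] //|[x|x] g h Gg Gh /=];
by rewrite actMin.
Qed.

Definition gset_sum S T (a : action G S) (b : action G T) : action G (S + T)%type :=
  Action (sum_is_action a b).

Lemma prod_is_action S T (a : action G S) (b : action G T) :
  is_action G (fun (u : (S * T)%type) g => (a u.1 g, b u.2 g)).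
Proof.
split=> [g [x y] [x' y'] /= [/actI-> /actI-> //]|[x y] g h Gg Gh /=].
by rewrite !actMin.
Qed.

Definition gset_prod S T (a : action G S) (b : action G T) : action G (S * T)%type :=
  Action (prod_is_action a b).

Lemma triv_is_action T : is_action G (fun (x : T) (g : gT) => x).
Proof. by split=> [g x y|]. Qed.

Definition gset_triv T : action G T := Action (triv_is_action T).

Lemma transport_is_action S T (a : action G T) (f : S -> T) (f' : T -> S) :
  cancel f f' -> cancel f' f -> is_action G (fun x g => f' (a (f x) g)).
Proof.
move=> fK f'K; split=> [g x y /(can_inj f'K)/actI/(can_inj fK)//|x g h Gg Gh].
by rewrite f'K actMin.
Qed.

Definition gset_ord (T : finType) (a : action G T) : action G 'I_#|T| :=
  Action (transport_is_action a (@enum_valK T) (@enum_rankK T)).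

Definition coset_space (H : {set gT}) : finType :=
  {A : {set gT} | A \in rcosets H G}.

Definition coset_mul (H : {set gT}) (A : coset_space H) (g : gT) :=
  if g \in G then insubd A (val A :* g) else A.

Lemma coset_mulE (H : {set gT}) (A : coset_space H) g :
  g \in G -> val (coset_mul A g) = val A :* g.
Proof.
rewrite /coset_mul => Gg; rewrite Gg val_insubd; case/rcosetsP: (valP A) => x Gx ->.
by case: rcosetsP => // -[]; exists (x * g)%g; rewrite ?groupM // rcosetM.
Qed.

Lemma coset_is_action (H : {set gT}) : is_action G (@coset_mul H).
Proof.
split=> [g A B|A g h Gg Gh].
  have [Gg|nGg] := boolP (g \in G); last by rewrite /coset_mul (negPf nGg).
  by move/(congr1 val); rewrite !coset_mulE // => /rcoset_inj/val_inj.
by apply: val_inj; rewrite !coset_mulE ?groupM // rcosetM.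
Qed.

(* The G-set G/H, as the set of right cosets Hg. *)
Definition gset_coset (H : {set gT}) : action G (coset_space H) :=
  Action (coset_is_action H).

Lemma gset_iso_refl S (a : action G S) : gset_iso a a.
Proof. by exists id => //; exists id. Qed.

Lemma gset_iso_sym S T (a : action G S) (b : action G T) :
  gset_iso a b -> gset_iso b a.
Proof.
case=> f [f' fK f'K] fG; exists f'; first by exists f.
by move=> x g Gg; rewrite -{1}(f'K x) -fG.
Qed.

Lemma gset_iso_trans S T U (a : action G S) (b : action G T) (c : action G U) :
  gset_iso a b -> gset_iso b c -> gset_iso a c.
Proof.
move=> [f fB fG] [h hB hG]; exists (h \o f); first exact: bij_comp.
by move=> x g Gg /=; rewrite fG ?hG.
Qed.

Lemma gset_ord_iso (T : finType) (a : action G T) : gset_iso (gset_ord a) a.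
Proof.
exists enum_val; first exact: enum_val_bij.
by move=> x g Gg /=; rewrite enum_rankK.
Qed.

Lemma gset_sum_iso S T U V (a : action G S) (b : action G T)
    (c : action G U) (d : action G V) :
  gset_iso a c -> gset_iso b d -> gset_iso (gset_sum a b) (gset_sum c d).
Proof.
move=> [f [f' fK f'K] fG] [h [h' hK h'K] hG].
exists (fun u => match u with inl x => inl (f x) | inr y => inr (h y) end).
  exists (fun u => match u with inl x => inl (f' x) | inr y => inr (h' y) end);
  by case=> x; rewrite ?fK ?f'K ?hK ?h'K.
by case=> x g Gg /=; rewrite ?fG ?hG.
Qed.

Lemma gset_prod_iso S T U V (a : action G S) (b : action G T)
    (c : action G U) (d : action G V) :
  gset_iso a c -> gset_iso b d -> gset_iso (gset_prod a b) (gset_prod c d).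
Proof.
move=> [f [f' fK f'K] fG] [h [h' hK h'K] hG].
exists (fun u => (f u.1, h u.2)).
  by exists (fun u => (f' u.1, h' u.2)); case=> x y; rewrite /= ?fK ?f'K ?hK ?h'K.
by case=> x y g Gg /=; rewrite fG ?hG.
Qed.

(* Isomorphism classes of finite G-sets. All of them are met on the carriers *)
(* 'I_n, which keeps the collection of representatives small.                *)
HB.instance Definition _ (T : Type) := gen_eqMixin (action G T).
HB.instance Definition _ (T : Type) := gen_choiceMixin (action G T).

Definition gset_rel (X Y : {n : nat & action G 'I_n}) : bool :=
  `[< gset_iso (tagged X) (tagged Y) >].

Lemma gset_rel_refl : reflexive gset_rel.
Proof. by move=> X; apply/asboolP/gset_iso_refl. Qed.

Lemma gset_rel_sym : symmetric gset_rel.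
Proof. by move=> X Y; apply/asboolP/asboolP; apply: gset_iso_sym. Qed.

Lemma gset_rel_trans : transitive gset_rel.
Proof.
move=> Y X Z /asboolP XY /asboolP YZ; apply/asboolP; exact: gset_iso_trans YZ.
Qed.

Canonical gset_equiv :=
  EquivRel gset_rel gset_rel_refl gset_rel_sym gset_rel_trans.

Definition gset_cls := {eq_quot gset_equiv}.
HB.instance Definition _ := Choice.on gset_cls.

Definition gcls (T : finType) (a : action G T) : gset_cls :=
  \pi_({eq_quot gset_equiv}) (Tagged (fun n => action G 'I_n) (gset_ord a)).

Definition grep (X : gset_cls) : {n : nat & action G 'I_n} :=
  repr (X : {eq_quot gset_equiv}).

Lemma gclsP (S T : finType) (a : action G S) (b : action G T) :
  gcls a = gcls b <-> gset_iso a b.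
Proof.
split=> [/eqquotP/asboolP/= i|i].
  apply: gset_iso_trans (gset_ord_iso b).
  exact: gset_iso_trans (gset_iso_sym (gset_ord_iso a)) i.
apply/eqquotP/asboolP/(gset_iso_trans (gset_ord_iso a)).
exact: gset_iso_trans i (gset_iso_sym (gset_ord_iso b)).
Qed.

Lemma grepK X : gcls (tagged (grep X)) = X.
Proof.
rewrite -[RHS](reprK (X : {eq_quot gset_equiv})).
by apply/eqquotP/asboolP/gset_ord_iso.
Qed.

Lemma grep_iso (T : finType) (a : action G T) : gset_iso (tagged (grep (gcls a))) a.
Proof. by apply/gclsP; rewrite grepK. Qed.

Definition gcls_add (X Y : gset_cls) : gset_cls :=
  gcls (gset_sum (tagged (grep X)) (tagged (grep Y))).

Definition gcls_mul (X Y : gset_cls) : gset_cls :=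
  gcls (gset_prod (tagged (grep X)) (tagged (grep Y))).

Definition gcls0 : gset_cls := gcls (gset_triv void).
Definition gcls1 : gset_cls := gcls (gset_triv unit).

Lemma gcls_addE (S T : finType) (a : action G S) (b : action G T) :
  gcls_add (gcls a) (gcls b) = gcls (gset_sum a b).
Proof. by apply/gclsP/gset_sum_iso; apply: grep_iso. Qed.

Lemma gcls_mulE (S T : finType) (a : action G S) (b : action G T) :
  gcls_mul (gcls a) (gcls b) = gcls (gset_prod a b).
Proof. by apply/gclsP/gset_prod_iso; apply: grep_iso. Qed.

Lemma gcls_addA : associative gcls_add.
Proof.
move=> X Y Z; rewrite -(grepK X) -(grepK Y) -(grepK Z) !gcls_addE.
apply/gclsP; exists (fun u => match u with
  | inl x => inl (inl x) | inr (inl y) => inl (inr y) | inr (inr z) => inr z end).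
  exists (fun u => match u with
    | inl (inl x) => inl x | inl (inr y) => inr (inl y) | inr z => inr (inr z) end);
  by [case=> [|[]] | case=> [[]|]].
by case=> [|[]].
Qed.

Lemma gcls_addC : commutative gcls_add.
Proof.
move=> X Y; rewrite -(grepK X) -(grepK Y) !gcls_addE; apply/gclsP.
exists (fun u => match u with inl x => inr x | inr y => inl y end); last by case.
by exists (fun u => match u with inl x => inr x | inr y => inl y end); case.
Qed.

Lemma gcls_add0 : left_id gcls0 gcls_add.
Proof.
move=> X; rewrite -(grepK X) gcls_addE; apply/gclsP.
exists (fun u : void + _ => match u with inl x => of_void _ x | inr y => y end).
  by exists inr => // -[].
by case.
Qed.

HB.instance Definition _ :=
  GRing.isNmodule.Build gset_cls gcls_addA gcls_addC gcls_add0.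

Lemma gcls_mulA : associative gcls_mul.
Proof.
move=> X Y Z; rewrite -(grepK X) -(grepK Y) -(grepK Z) !gcls_mulE.
apply/gclsP; exists (fun u => ((u.1, u.2.1), u.2.2)); last by case=> ? [].
by exists (fun u => (u.1.1, (u.1.2, u.2))); [case=> ? [] | case=> [[]]].
Qed.

Lemma gcls_mulC : commutative gcls_mul.
Proof.
move=> X Y; rewrite -(grepK X) -(grepK Y) !gcls_mulE; apply/gclsP.
exists (fun u => (u.2, u.1)); last by case.
by exists (fun u => (u.2, u.1)); case.
Qed.

Lemma gcls_mul1 : left_id gcls1 gcls_mul.
Proof.
move=> X; rewrite -(grepK X) gcls_mulE; apply/gclsP.
by exists snd; [exists (pair tt) => // -[[]] | case].
Qed.

Lemma gcls_mulDl : left_distributive gcls_mul +%R.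
Proof.
move=> X Y Z; rewrite -(grepK X) -(grepK Y) -(grepK Z).
rewrite [_ + _]gcls_addE !gcls_mulE [RHS]gcls_addE; apply/gclsP.
exists (fun u => match u.1 with inl x => inl (x, u.2) | inr y => inr (y, u.2) end).
  exists (fun u => match u with inl x => (inl x.1, x.2) | inr y => (inr y.1, y.2) end);
  by [case=> [[]] | case=> [[]|[]]].
by case=> [[]].
Qed.

Lemma gcls_mul0 : left_zero gcls0 gcls_mul.
Proof.
move=> X; rewrite -(grepK X) gcls_mulE; apply/gclsP.
by exists fst; [exists (of_void _) => [[[]]|[]] | case=> [[]]].
Qed.

HB.instance Definition _ := GRing.Nmodule_isComPzSemiRing.Build gset_cls
  gcls_mulA gcls_mulC gcls_mul1 gcls_mulDl gcls_mul0.

Definition burnside := groth gset_cls.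
HB.instance Definition _ := GRing.ComPzRing.on burnside.

Definition burnside_class (T : finType) (a : action G T) : burnside :=
  groth_in (gcls a).

Definition fixcount (K : {set gT}) (X : gset_cls) : int :=
  #|'Fix_(tagged (grep X))(K)|.

Definition mark (K : {set gT}) : burnside -> int := groth_ext (fixcount K).

Lemma fixcountE K (T : finType) (a : action G T) :
  K \subset G -> fixcount K (gcls a) = #|'Fix_a(K)|.
Proof.
move=> sKG; rewrite /fixcount; congr (Posz _).
have [f [f' fK f'K] fG] := grep_iso a.
rewrite -(card_imset _ (can_inj fK)); apply: eq_card => y.
apply/imsetP/afixP => [[x /afixP xK ->] g Kg|yK].
  by rewrite -fG ?(subsetP sKG) ?xK.
exists (f' y); rewrite ?f'K //; apply/afixP => g Kg; apply: (can_inj fK).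
by rewrite fG ?(subsetP sKG) // f'K yK.
Qed.

Lemma fixcountD K : K \subset G -> {morph fixcount K : X Y / X + Y}.
Proof.
move=> sKG X Y; rewrite -(grepK X) -(grepK Y) [_ + _]gcls_addE !fixcountE //.
rewrite -PoszD -!sum1_card big_sumType; congr (Posz (_ + _)%N);
apply: eq_bigl => x; apply/afixP/afixP => xK g Kg;
  by [case: (xK g Kg) | rewrite /= xK].
Qed.

Lemma mark_zmod_morphism K : K \subset G -> zmod_morphism (mark K).
Proof. by move=> sKG; apply/groth_ext_zmod_morphism/fixcountD. Qed.

Lemma markE K T (a : action G T) :
  K \subset G -> mark K (burnside_class a) = #|'Fix_a(K)|.
Proof.
move=> sKG; have fD := fixcountD sKG; rewrite /mark groth_extE // fixcountE //.
have /(canRL (addrK _)) : fixcount K 0 + fixcount K 0 = fixcount K 0.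
  by rewrite -fD addr0.
by rewrite subrr => ->; rewrite subr0.
Qed.

End GSets.

Section CrossedGSets.
Variables (gT : finGroupType) (G : {group gT}).
Implicit Types (S T U V : finType).

Record crossed T := Crossed {
  cact :> action G T;
  clabel : T -> gT;
  clabelG : forall x, clabel x \in G;
  clabelJ : forall x, {in G, forall g, clabel (cact x g) = (clabel x ^ g)%g}
}.

Definition crossed_iso S T (X : crossed S) (Y : crossed T) :=
  exists2 f : S -> T, bijective f &
    equivariant X Y f /\ forall x, clabel Y (f x) = clabel X x.

Definition crossed_sum S T (X : crossed S) (Y : crossed T) :
  crossed (S + T)%type.
Proof.
refine (@Crossed _ (gset_sum X Y)
  (fun u => match u with inl x => clabel X x | inr y => clabel Y y end) _ _).
- by case=> x; apply: clabelG.
- by case=> x g Gg /=; apply: clabelJ.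
Defined.

Definition crossed_prod S T (X : crossed S) (Y : crossed T) :
  crossed (S * T)%type.
Proof.
refine (@Crossed _ (gset_prod X Y)
  (fun u => (clabel X u.1 * clabel Y u.2)%g) _ _).
- by move=> u; rewrite groupM ?clabelG.
- by move=> u g Gg /=; rewrite !clabelJ // conjMg.
Defined.

Definition crossed_const T (a : action G T) : crossed T.
Proof.
refine (@Crossed _ a (fun _ => 1%g) _ _) => x; first exact: group1.
by move=> g Gg; rewrite conj1g.
Defined.

Definition crossed_ord T (X : crossed T) : crossed 'I_#|T|.
Proof.
refine (@Crossed _ (gset_ord X) (fun i => clabel X (enum_val i)) _ _) => i.
  exact: clabelG.
by move=> g Gg /=; rewrite enum_rankK clabelJ.
Defined.

Lemma conj_repr_rcoset (H : {group gT}) a x :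
  a \in 'C_G(H)%g -> (a ^ fingroup.repr (H :* x) = a ^ x)%g.
Proof.
case/setIP=> _ /centP cHa; have /rcosetP[h Hh ->] := mem_repr_rcoset H x.
by rewrite conjgM; congr (_ ^ _)%g; rewrite /conjg (cHa h Hh) mulKg.
Qed.

(* (G/H, gH |-> g a g^-1), in terms of right cosets: Hg |-> a ^ g. *)
Definition crossed_coset (H : {group gT}) (a : gT) (aCH : a \in 'C_G(H)%g) :
  crossed (coset_space G H).
Proof.
refine (@Crossed _ (gset_coset G H) (fun A => a ^ fingroup.repr (val A))%g _ _)
  => A; case/rcosetsP: (valP A) => x Gx eA.
  by rewrite eA conj_repr_rcoset // groupJ //; case/setIP: aCH.
by move=> g Gg; rewrite coset_mulE // eA -rcosetM !conj_repr_rcoset // conjgM.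
Defined.

Lemma crossed_iso_refl S (X : crossed S) : crossed_iso X X.
Proof. by exists id => //; exists id. Qed.

Lemma crossed_iso_sym S T (X : crossed S) (Y : crossed T) :
  crossed_iso X Y -> crossed_iso Y X.
Proof.
case=> f [f' fK f'K] [fG fl]; exists f'; first by exists f.
split=> [x g Gg|x]; first by rewrite -{1}(f'K x) -fG.
by rewrite -{2}(f'K x) fl.
Qed.

Lemma crossed_iso_trans S T U (X : crossed S) (Y : crossed T) (Z : crossed U) :
  crossed_iso X Y -> crossed_iso Y Z -> crossed_iso X Z.
Proof.
move=> [f fB [fG fl]] [h hB [hG hl]]; exists (h \o f); first exact: bij_comp.
by split=> [x g Gg|x] /=; rewrite ?fG ?hG // hl.
Qed.

Lemma crossed_ord_iso T (X : crossed T) : crossed_iso (crossed_ord X) X.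
Proof.
exists enum_val; first exact: enum_val_bij.
by split=> // x g Gg /=; rewrite enum_rankK.
Qed.

Lemma crossed_sum_iso S T U V (X : crossed S) (Y : crossed T)
    (Z : crossed U) (W : crossed V) :
  crossed_iso X Z -> crossed_iso Y W ->
  crossed_iso (crossed_sum X Y) (crossed_sum Z W).
Proof.
move=> [f [f' fK f'K] [fG fl]] [h [h' hK h'K] [hG hl]].
exists (fun u => match u with inl x => inl (f x) | inr y => inr (h y) end).
  exists (fun u => match u with inl x => inl (f' x) | inr y => inr (h' y) end);
  by case=> x; rewrite ?fK ?f'K ?hK ?h'K.
by split=> [[x|x] g Gg|[x|x]] /=; rewrite ?fG ?hG.
Qed.

Lemma crossed_prod_iso S T U V (X : crossed S) (Y : crossed T)
    (Z : crossed U) (W : crossed V) :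
  crossed_iso X Z -> crossed_iso Y W ->
  crossed_iso (crossed_prod X Y) (crossed_prod Z W).
Proof.
move=> [f [f' fK f'K] [fG fl]] [h [h' hK h'K] [hG hl]].
exists (fun u => (f u.1, h u.2)).
  by exists (fun u => (f' u.1, h' u.2)); case=> x y; rewrite /= ?fK ?f'K ?hK ?h'K.
by split=> [[x y] g Gg|[x y]] /=; rewrite ?fG ?hG ?fl ?hl.
Qed.

HB.instance Definition _ T := gen_eqMixin (crossed T).
HB.instance Definition _ T := gen_choiceMixin (crossed T).

Definition crossed_rel (X Y : {n : nat & crossed 'I_n}) : bool :=
  `[< crossed_iso (tagged X) (tagged Y) >].

Lemma crossed_rel_refl : reflexive crossed_rel.
Proof. by move=> X; apply/asboolP/crossed_iso_refl. Qed.

Lemma crossed_rel_sym : symmetric crossed_rel.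
Proof. by move=> X Y; apply/asboolP/asboolP; apply: crossed_iso_sym. Qed.

Lemma crossed_rel_trans : transitive crossed_rel.
Proof.
move=> Y X Z /asboolP XY /asboolP YZ; apply/asboolP.
exact: crossed_iso_trans YZ.
Qed.

Canonical crossed_equiv :=
  EquivRel crossed_rel crossed_rel_refl crossed_rel_sym crossed_rel_trans.

Definition crossed_cls := {eq_quot crossed_equiv}.
HB.instance Definition _ := Choice.on crossed_cls.

Definition ccls T (X : crossed T) : crossed_cls :=
  \pi_({eq_quot crossed_equiv}) (Tagged (fun n => crossed 'I_n) (crossed_ord X)).

Definition crep (c : crossed_cls) : {n : nat & crossed 'I_n} :=
  repr (c : {eq_quot crossed_equiv}).

Lemma cclsP S T (X : crossed S) (Y : crossed T) :
  ccls X = ccls Y <-> crossed_iso X Y.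
Proof.
split=> [/eqquotP/asboolP/= i|i].
  apply: crossed_iso_trans (crossed_ord_iso Y).
  exact: crossed_iso_trans (crossed_iso_sym (crossed_ord_iso X)) i.
apply/eqquotP/asboolP/(crossed_iso_trans (crossed_ord_iso X)).
exact: crossed_iso_trans i (crossed_iso_sym (crossed_ord_iso Y)).
Qed.

Lemma crepK c : ccls (tagged (crep c)) = c.
Proof.
rewrite -[RHS](reprK (c : {eq_quot crossed_equiv})).
by apply/eqquotP/asboolP/crossed_ord_iso.
Qed.

Lemma crep_iso T (X : crossed T) : crossed_iso (tagged (crep (ccls X))) X.
Proof. by apply/cclsP; rewrite crepK. Qed.

Definition ccls_add (c d : crossed_cls) : crossed_cls :=
  ccls (crossed_sum (tagged (crep c)) (tagged (crep d))).

Definition ccls_mul (c d : crossed_cls) : crossed_cls :=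
  ccls (crossed_prod (tagged (crep c)) (tagged (crep d))).

Definition ccls0 : crossed_cls := ccls (crossed_const (gset_triv G void)).
Definition ccls1 : crossed_cls := ccls (crossed_const (gset_triv G unit)).

Lemma ccls_addE S T (X : crossed S) (Y : crossed T) :
  ccls_add (ccls X) (ccls Y) = ccls (crossed_sum X Y).
Proof. by apply/cclsP/crossed_sum_iso; apply: crep_iso. Qed.

Lemma ccls_mulE S T (X : crossed S) (Y : crossed T) :
  ccls_mul (ccls X) (ccls Y) = ccls (crossed_prod X Y).
Proof. by apply/cclsP/crossed_prod_iso; apply: crep_iso. Qed.

Lemma ccls_addA : associative ccls_add.
Proof.
move=> X Y Z; rewrite -(crepK X) -(crepK Y) -(crepK Z) !ccls_addE.
apply/cclsP; exists (fun u => match u with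
  | inl x => inl (inl x) | inr (inl y) => inl (inr y) | inr (inr z) => inr z end).
  exists (fun u => match u with
    | inl (inl x) => inl x | inl (inr y) => inr (inl y) | inr z => inr (inr z) end);
  by [case=> [|[]] | case=> [[]|]].
by split; case=> [|[]].
Qed.

Lemma ccls_addC : commutative ccls_add.
Proof.
move=> X Y; rewrite -(crepK X) -(crepK Y) !ccls_addE; apply/cclsP.
exists (fun u => match u with inl x => inr x | inr y => inl y end).
  by exists (fun u => match u with inl x => inr x | inr y => inl y end); case.
by split; case.
Qed.

Lemma ccls_add0 : left_id ccls0 ccls_add.
Proof.
move=> X; rewrite -(crepK X) ccls_addE; apply/cclsP.
exists (fun u : void + _ => match u with inl x => of_void _ x | inr y => y end).
  by exists inr => // -[].
by split; case.
Qed.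

HB.instance Definition _ :=
  GRing.isNmodule.Build crossed_cls ccls_addA ccls_addC ccls_add0.

Lemma ccls_mulA : associative ccls_mul.
Proof.
move=> X Y Z; rewrite -(crepK X) -(crepK Y) -(crepK Z) !ccls_mulE.
apply/cclsP; exists (fun u => ((u.1, u.2.1), u.2.2)).
  by exists (fun u => (u.1.1, (u.1.2, u.2))); [case=> ? [] | case=> [[]]].
by split; case=> ? [] //= ? ?; rewrite mulgA.
Qed.

(* (x, y) |-> (y, x^beta(y)) *)
Lemma ccls_mulC : commutative ccls_mul.
Proof.
move=> c d; rewrite -(crepK c) -(crepK d) !ccls_mulE; apply/cclsP.
set X := tagged _; set Y := tagged _.
exists (fun u => (u.2, X u.1 (clabel Y u.2))).
  exists (fun u => (X u.2 (clabel Y u.1)^-1%g, u.1)); case=> x y /=.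
    by rewrite -actMin ?groupV ?clabelG // mulgV act1.
  by rewrite -actMin ?groupV ?clabelG // mulVg act1.
split=> [[x y] g Gg|[x y]] /=.
  rewrite clabelJ // -!actMin ?groupJ ?clabelG //.
  by rewrite -conjgC.
by rewrite clabelJ ?clabelG // -conjgC.
Qed.

Lemma ccls_mul1 : left_id ccls1 ccls_mul.
Proof.
move=> X; rewrite -(crepK X) ccls_mulE; apply/cclsP.
exists snd; first by exists (pair tt) => // -[[]].
by split; case=> //= ? ?; rewrite mul1g.
Qed.

Lemma ccls_mulDl : left_distributive ccls_mul +%R.
Proof.
move=> X Y Z; rewrite -(crepK X) -(crepK Y) -(crepK Z).
rewrite [_ + _]ccls_addE !ccls_mulE [RHS]ccls_addE; apply/cclsP.
exists (fun u => match u.1 with inl x => inl (x, u.2) | inr y => inr (y, u.2) end).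
  exists (fun u => match u with inl x => (inl x.1, x.2) | inr y => (inr y.1, y.2) end);
  by [case=> [[]] | case=> [[]|[]]].
by split; case=> [[]].
Qed.

Lemma ccls_mul0 : left_zero ccls0 ccls_mul.
Proof.
move=> X; rewrite -(crepK X) ccls_mulE; apply/cclsP.
exists fst; first by exists (of_void _) => [[[]]|[]].
by split; case=> [[]].
Qed.

HB.instance Definition _ := GRing.Nmodule_isComPzSemiRing.Build crossed_cls
  ccls_mulA ccls_mulC ccls_mul1 ccls_mulDl ccls_mul0.

Definition crossed_burnside := groth crossed_cls.
HB.instance Definition _ := GRing.ComPzRing.on crossed_burnside.

(* Elements of B^c(G) are the differences of such classes (gdiffK, gdiff_in  *)
(* and crepK).                                                               *)
Definition crossed_class T (X : crossed T) : crossed_burnside :=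
  groth_in (ccls X).

(* [X] |-> [(X, x |-> 1)]; by crossed_iota_zmod_morphism and                 *)
(* crossed_iota_coset it is the additive map with [G/U] |-> [U, 1]_G.        *)
Definition crossed_iota_cls (X : gset_cls G) : crossed_burnside :=
  crossed_class (crossed_const (tagged (grep X))).

Definition crossed_iota : burnside G -> crossed_burnside := groth_ext crossed_iota_cls.

Lemma crossed_iota_clsE T (a : action G T) :
  crossed_iota_cls (gcls a) = crossed_class (crossed_const a).
Proof.
congr groth_in; apply/cclsP; have [f fB fG] := grep_iso a.
by exists f.
Qed.

Lemma crossed_iota_clsD : {morph crossed_iota_cls : X Y / X + Y}.
Proof.
move=> X Y; rewrite -(grepK X) -(grepK Y) [_ + _]gcls_addE !crossed_iota_clsE.
rewrite [RHS]gdiffD addr0; congr gdiff.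
rewrite [RHS]ccls_addE; apply/cclsP; exists id; first by exists id.
by split=> [|[]].
Qed.

Lemma crossed_iota_zmod_morphism : zmod_morphism crossed_iota.
Proof. exact/groth_ext_zmod_morphism/crossed_iota_clsD. Qed.

Lemma crossed_iota_class T (a : action G T) :
  crossed_iota (burnside_class a) = crossed_class (crossed_const a).
Proof.
rewrite -crossed_iota_clsE /crossed_iota groth_extE; last exact: crossed_iota_clsD.
have /(canRL (addrK _)) : crossed_iota_cls 0 + crossed_iota_cls 0 = crossed_iota_cls 0.
  by rewrite -crossed_iota_clsD addr0.
by rewrite subrr => ->; rewrite subr0.
Qed.

Lemma crossed_iota_coset (U : {group gT}) :
  crossed_iota (burnside_class (gset_coset G U)) =
  crossed_class (crossed_coset (group1 'C_G(U))).
Proof.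
rewrite crossed_iota_class; congr groth_in; apply/cclsP; exists id; first by exists id.
by split=> // x /=; rewrite conj1g.
Qed.

End CrossedGSets.

Section Idempotents.
Variables (gT : finGroupType) (G : {group gT}).
Implicit Types H J K N : {group gT}.

Definition conj_subgroups (H K : {group gT}) : bool := H \in orbit 'JG%act G K.

(* e^G_H; Q (x) B(G) has exactly one such element, so 0 is never used. *)
Definition burnside_idem (H : {group gT}) : qtens (burnside G) :=
  classical_sets.xget 0 (fun e => primitive_idempotent e /\
    forall K : {group gT}, K \subset G ->
      qtens_ext (mark K) e = (conj_subgroups K H)%:R).

Definition sol_residual (H : {group gT}) : {group gT} :=
  [group of \bigcap_(N : {group gT} | (N <| H) && solvable (H / N)) N].

Lemma sol_residualP H :
  [/\ sol_residual H <| H, solvable (H / sol_residual H)%g &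
      forall N, N <| H -> solvable (H / N)%g -> sol_residual H \subset N].
Proof.
have sub N : N <| H -> solvable (H / N)%g -> sol_residual H \subset N.
  by move=> nN sN; apply: bigcap_inf; rewrite nN.
have nR : sol_residual H <| H.
  apply/andP; split.
    by apply: sub; rewrite ?normal_refl ?trivg_quotient ?solvable1.
  by apply: norms_bigcap; apply/bigcapsP => N /andP[/andP[]].
split=> //; apply/derivedP.
suff [n sn] : exists n, H^`(n)%g \subset sol_residual H.
  exists n; rewrite -quotient_der ?normal_norm //; apply/trivgP.
  by rewrite quotient_sub1 // (subset_trans (der_sub _ _)) ?normal_norm.
rewrite /=; elim/big_ind: _ => [|A B [n sA] [m sB]|N /andP[nN /derivedP[n]]].
- by exists 0%N; rewrite subsetT.
- have der_le k l : (k <= l)%N -> H^`(l)%g \subset H^`(k)%g.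
    by move/subnKC <-; elim: (l - k)%N => [|i IH];
      rewrite ?addn0 // addnS (subset_trans (der_subS _ _)).
  by exists (n + m)%N; rewrite subsetI (subset_trans _ sA) ?(subset_trans _ sB)
    ?der_le ?leq_addr ?leq_addl.
- rewrite -quotient_der ?normal_norm // => /trivgP.
  rewrite quotient_sub1; first by exists n.
  by rewrite (subset_trans (der_sub _ _)) ?normal_norm.
Qed.

(* f^G_J, for C a set of representatives of the subgroups of G up to         *)
(* conjugacy: the element of B(G) whose image in Q (x) B(G) is the sum       *)
(* below; it exists by Dress's theorem and is unique as B(G) is torsion-free. *)
Definition dress_idem (C : {set {group gT}}) (J : {group gT}) : burnside G :=
  classical_sets.xget 0 (fun f =>
    qtens_in f = \sum_(H in C | conj_subgroups (sol_residual H) J) burnside_idem H).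

Definition perfect (H : {group gT}) : bool := [~: H, H]%g == H.

Definition conj_representatives (C D : {set {group gT}}) : bool :=
  is_transversal C (orbit 'JG%act G @: D) D.

End Idempotents.

(* Main.v *)
From HB Require Import structures.
Require Import Defs.
From mathcomp Require Import all_boot all_fingroup all_solvable all_algebra.
From mathcomp Require Import boolp.
From mathcomp Require classical_sets.

(* For K <= G, sending a crossed G-set X to the sum of the labels of its K-fixed
   points is a ring morphism from B^c(G) to the integral group ring of G, and
   these morphisms are jointly injective. An integral group ring of a finite
   group has no idempotents but 0 and 1 (in the regular representation the rank
   of an idempotent is its trace, a multiple of the group order), so every
   idempotent of B^c(G) is determined by its image in B(G) under the ring
   morphism forgetting the labels, a retraction of iota: iota and this retraction
   are inverse bijections between the idempotents of the two rings.

   For B(G), a conjugation-invariant function on subgroups satisfying the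
   Cauchy-Frobenius congruences is a vector of marks, which produces f_J. These
   congruences also force the mark of an idempotent to
   be the same at K and at a normal subgroup of prime index, hence at the
   solvable residual of K, so that the f_J are exactly the primitive ones. *)

Set Implicit Arguments.
Unset Strict Implicit.
Unset Printing Implicit Defensive.

Import GroupScope GRing.Theory Num.Theory.
Local Open Scope ring_scope.

(** * Extensions to Grothendieck groups and integral idempotent matrices *)

Section GrothendieckExtension.
Variable S : comPzSemiRingType.

Lemma groth_ind (P : groth S -> Prop) :
  (forall a b, P (groth_in a - groth_in b)) -> forall x, P x.
Proof. by move=> PS x; rewrite -(gdiffK x) gdiff_in. Qed.

Lemma groth_inD : {morph @groth_in S : a b / a + b}.
Proof. by move=> a b; rewrite /groth_in gdiffD addr0. Qed.

Lemma groth_inM : {morph @groth_in S : a b / a * b}.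
Proof. by move=> a b; rewrite /groth_in gdiffM !mulr0 mul0r !addr0. Qed.

Lemma groth_ext_in (A : zmodType) (f : S -> A) a :
  {morph f : u v / u + v} -> groth_ext f (groth_in a) = f a.
Proof.
move=> fD; rewrite groth_extE //; have := fD 0 0; rewrite addr0.
by move/esym/(canRL (addrK _)); rewrite subrr => ->; rewrite subr0.
Qed.

Lemma groth_extM (A : pzRingType) (f : S -> A) :
  {morph f : u v / u + v} -> {morph f : u v / u * v} ->
  {morph groth_ext f : x y / x * y}.
Proof.
move=> fD fM x y; rewrite -(gdiffK x) -(gdiffK y) gdiffM !groth_extE // !fD !fM.
by rewrite mulrBl !mulrBr opprB opprD addrACA addrA.
Qed.

End GrothendieckExtension.

Lemma zmod_morphismD (A B : zmodType) (f : A -> B) :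
  zmod_morphism f -> {morph f : x y / x + y}.
Proof.
move=> fB; pose m := GRing.isZmodMorphism.Build _ _ f fB.
exact: (raddfD (HB.pack f m : {additive A -> B})).
Qed.

Lemma zmod_morphismMn (A B : zmodType) (f : A -> B) n :
  zmod_morphism f -> {morph f : x / x *+ n}.
Proof.
move=> fB; pose m := GRing.isZmodMorphism.Build _ _ f fB.
exact: (raddfMn (HB.pack f m : {additive A -> B})).
Qed.

Lemma zmod_morphismMz (A B : zmodType) (f : A -> B) (n : int) :
  zmod_morphism f -> {morph f : x / x *~ n}.
Proof.
move=> fB; pose m := GRing.isZmodMorphism.Build _ _ f fB.
exact: (raddfMz (HB.pack f m : {additive A -> B}) n).
Qed.

Lemma zmod_morphism0 (A B : zmodType) (f : A -> B) :
  zmod_morphism f -> f 0 = 0.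
Proof. by move=> fB; rewrite -(subrr 0) fB subrr. Qed.

(** Write [P] as its column base times its row base. Idempotence lets these full-rank factors be
    cancelled, so their product in the reverse order is the identity of size [\rank P]. *)
Lemma idempotent_mx_trace (F : fieldType) n (P : 'M[F]_n) :
  P *m P = P -> \tr P = (\rank P)%:R.
Proof.
move=> PP; rewrite -[in LHS](mulmx_base P) mxtrace_mulC.
suff ->: row_base P *m col_base P = 1%:M by rewrite mxtrace1.
apply: (row_full_inj (col_base_full P)); apply: (row_free_inj (row_base_free P)).
by rewrite mulmx1 mulmxA mulmx_base -mulmxA mulmx_base.
Qed.

(* The regular representation turns the triviality of idempotents in integral
   group rings into this: the trace [n * t] is the rank, hence [t] is 0 or 1. *)
Lemma idempotent_intmx_const_diag n (P : 'M[int]_n) t :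
  P *m P = P -> (forall i, P i i = t) -> P = 0 \/ P = 1%:M.
Proof.
move=> PP Pt; case: n => [|n] in P PP Pt *; first by left; apply: flatmx0.
pose Q : 'M[rat]_n.+1 := map_mx intr P.
have QQ : Q *m Q = Q by rewrite -map_mxM PP.
have Q_inj : injective (map_mx intr : 'M[int]_n.+1 -> 'M[rat]_n.+1).
  move=> A B /matrixP AB; apply/matrixP=> i j; have := AB i j.
  by rewrite !mxE => /intr_inj.
have: (t *+ n.+1)%:~R = (\rank Q)%:R :> rat.
  rewrite -idempotent_mx_trace // /mxtrace rmorphMn.
  by under eq_bigr do rewrite mxE Pt; rewrite sumr_const card_ord.
rewrite -[RHS]/((\rank Q)%:Z%:~R) => /intr_inj.
(* For [t = 0] the rank is 0. For [t > 0] it is at least [n.+1], so [Q] can be cancelled from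
   [Q *m Q = Q]. A negative [t] would make the rank negative. *)
case: t Pt => [[|t]|t] Pt.
- rewrite mul0rn => /esym/eqP; rewrite -[0]/(Posz 0) eqz_nat mxrank_eq0 => /eqP Q0.
  by left; apply: Q_inj; rewrite map_mx0.
- rewrite -natz -mulrnA natz => /eqP; rewrite eqz_nat => /eqP e.
  right; apply: Q_inj; rewrite map_mx1; have: row_free Q.
    rewrite /row_free eqn_leq rank_leq_row -e mulSn; exact: leq_addr.
  by move/row_free_inj; apply; rewrite -/Q mul1mx.
- move=> e; have: (0 <= Negz t *+ n.+1)%R by rewrite e.
  by rewrite pmulrn_lge0.
Qed.

(** * Isomorphism of crossed G-sets *)

Section CrossedMarks.
Variables (gT : finGroupType) (G : {group gT}).
Implicit Types (S T : finType) (K L : {group gT}).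

(** For [K] in [G] and [a] in ['C_G(K)], its cardinality counts the morphisms to [X] from a crossed
    [G]-set of class [[K, a]_G]: a crossed analogue of marks. *)
Definition crossed_fix T (X : crossed G T) (K : {set gT}) (a : gT) : {set T} :=
  [set x in 'Fix_X(K) | clabel X x == a].

Lemma crossed_fixE T (X : crossed G T) (K : {set gT}) a x :
  (x \in crossed_fix X K a) = (x \in 'Fix_X(K)) && (clabel X x == a).
Proof. exact: in_set. Qed.

(** The function is defined on all of [S], so that orbits can be removed and glued back without
    changing the carrier types. *)
Definition crossed_iso_on S T (X : crossed G S) (Y : crossed G T)
    (A : {set S}) (B : {set T}) (f : S -> T) :=
  [/\ {in A &, injective f}, f @: A = B,
      {in A, forall x, {in G, forall g, f (X x g) = Y (f x) g}} &
      {in A, forall x, clabel Y (f x) = clabel X x}].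

Lemma crossed_iso_on_card S T (X : crossed G S) (Y : crossed G T) A B f K a :
  K \subset G -> [acts G, on A | X] -> crossed_iso_on X Y A B f ->
  #|A :&: crossed_fix X K a| = #|B :&: crossed_fix Y K a|.
Proof.
move=> sKG actA [f_inj fA fG fl].
have /card_in_imset <-: {in A :&: crossed_fix X K a &, injective f}.
  by move=> x y /setIP[Ax _] /setIP[Ay _]; apply: f_inj.
apply: eq_card => y; apply/imsetP/idP.
  case=> x /setIP[Ax]; rewrite inE => /andP[/afixP xK /eqP xa] ->.
  rewrite inE -fA imset_f //= inE fl // xa eqxx andbT; apply/afixP => g Kg.
  by rewrite -fG ?(subsetP sKG) // xK.
case/setIP; rewrite -fA => /imsetP[x Ax ->]; rewrite inE => /andP[/afixP yK yl].
exists x => //; rewrite inE Ax inE -(fl x) // yl andbT; apply/afixP => g Kg.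
have Gg := subsetP sKG g Kg.
apply: f_inj => //; first by rewrite (acts_act actA).
by rewrite fG ?yK.
Qed.

Lemma crossed_iso_onT S T (X : crossed G S) (Y : crossed G T) :
  crossed_iso X Y <-> exists f, crossed_iso_on X Y setT setT f.
Proof.
split=> [[f [f' fK f'K] [fG fl]]|[f [f_inj fT fG fl]]]; exists f.
- split=> // [x y _ _ /(can_inj fK) //|].
  by apply/setP=> y; rewrite inE -[y]f'K imset_f.
- have f_sur y : exists x, f x == y.
    have: y \in f @: setT by rewrite fT inE.
    by case/imsetP=> x _ ->; exists x.
  exists (fun y => xchoose (f_sur y)) => [x|y]; last exact/eqP/(xchooseP (f_sur y)).
  by apply: f_inj; rewrite ?inE //; apply/eqP/(xchooseP (f_sur (f x))).
- by split=> [x g|x]; [apply: fG | apply: fl].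
Qed.

Lemma acts_full T (a : action G T) : [acts G, on setT | a].
Proof.
by apply/subsetP=> g Gg; rewrite !inE Gg /=; apply/subsetP=> x; rewrite !inE.
Qed.

Lemma crossed_fix_iso S T (X : crossed G S) (Y : crossed G T) K a :
  K \subset G -> crossed_iso X Y ->
  #|crossed_fix X K a| = #|crossed_fix Y K a|.
Proof.
move=> sKG /crossed_iso_onT[f XY].
rewrite -(setTI (crossed_fix X K a)) -(setTI (crossed_fix Y K a)).
apply: (crossed_iso_on_card a sKG _ XY).
exact: acts_full.
Qed.

Lemma stabE T (a : action G T) x g :
  (g \in 'C_G[x | a]) = (g \in G) && (a x g == x).
Proof.
by rewrite !inE sub1set inE; case: (g \in G).
Qed.

(** A transitive crossed [G]-set is determined by the stabilizer and the label of one point: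
    [X x g |-> Y y g] is well defined and injective because the stabilizers agree. *)
Lemma crossed_orbit_iso S T (X : crossed G S) (Y : crossed G T) x y :
  'C_G[x | X] = 'C_G[y | Y] -> clabel X x = clabel Y y ->
  exists f, crossed_iso_on X Y (orbit X G x) (orbit Y G y) f.
Proof.
move=> eqC eql.
(* Some [g] carrying [x] to [z] is picked; [y] is the default value off the orbit. *)
pose f z := if [pick g in G | X x g == z] is Some g then Y y g else y.
have stab2 g h : g \in G -> h \in G -> (X x g == X x h) = (Y y g == Y y h).
  move=> Gg Gh; have Ggh : (g * h^-1)%g \in G by rewrite groupM ?groupV.
  have stab (U : finType) (Z : action G U) z :
      (Z z g == Z z h) = ((g * h^-1)%g \in 'C_G[z | Z]).
    rewrite stabE Ggh /=; apply/eqP/eqP => [e|].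
      by rewrite actMin ?groupV // e -actMin ?groupV // mulgV act1.
    by rewrite actMin ?groupV // => /(canRL (actKVin _ Gh)).
  by rewrite !stab eqC.
have fE g : g \in G -> f (X x g) = Y y g.
  move=> Gg; rewrite /f; case: pickP => [h /andP[Gh]|/(_ g)].
    by rewrite stab2 // => /eqP.
  by rewrite Gg eqxx.
exists f; split.
- move=> _ _ /orbitP[g Gg <-] /orbitP[h Gh <-]; rewrite !fE // => /eqP.
  by rewrite -stab2 // => /eqP.
- apply/setP=> z; apply/imsetP/orbitP => [[_ /orbitP[g Gg <-] ->]|[g Gg <-]].
    by exists g; rewrite ?fE.
  by exists (X x g); rewrite ?fE // mem_orbit.
- by move=> _ /orbitP[g Gg <-] h Gh; rewrite -actMin // !fE ?groupM // actMin.
- by move=> _ /orbitP[g Gg <-]; rewrite fE // !clabelJ // eql.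
Qed.

Lemma crossed_iso_onU S T (X : crossed G S) (Y : crossed G T)
    (A A' : {set S}) (B B' : {set T}) f f' :
  [acts G, on A | X] -> [disjoint A & A'] -> [disjoint B & B'] ->
  crossed_iso_on X Y A B f -> crossed_iso_on X Y A' B' f' ->
  crossed_iso_on X Y (A :|: A') (B :|: B') (fun x => if x \in A then f x else f' x).
Proof.
move=> actA dA dB [f_inj fA fG fl] [f'_inj fA' fG' fl'].
have A'F x : x \in A' -> (x \in A) = false.
  by move=> A'x; apply/negP=> Ax; have /pred0P/(_ x)/= := dA; rewrite Ax A'x.
have neq x x' : x \in A -> x' \in A' -> f x <> f' x'.
  move=> Ax A'x' e; have /pred0P/(_ (f x))/= := dB.
  by rewrite -fA imset_f //= e -fA' imset_f.
split.
- move=> x x' /setUP[Ax|A'x] /setUP[Ax'|A'x']; rewrite ?Ax ?Ax' ?(A'F x) ?(A'F x') //.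
  + exact: f_inj.
  + by move/neq; case.
  + by move/esym/neq; case.
  + exact: f'_inj.
- rewrite imsetU -fA -fA'; congr (_ :|: _); apply: eq_in_imset => x Ax.
    by rewrite Ax.
  by rewrite A'F.
- move=> x /setUP[Ax|A'x] g Gg; rewrite (acts_act actA) ?Ax ?A'F //.
    exact: fG.
  exact: fG'.
- by move=> x /setUP[Ax|A'x]; rewrite ?Ax ?A'F ?fl ?fl'.
Qed.

Lemma orbit_subset T (a : action G T) (A : {set T}) x :
  [acts G, on A | a] -> x \in A -> orbit a G x \subset A.
Proof.
by move=> actA Ax; apply/subsetP=> _ /orbitP[g Gg <-]; rewrite (acts_act actA).
Qed.

Lemma acts_setD T (a : action G T) (A B : {set T}) :
  [acts G, on A | a] -> [acts G, on B | a] -> [acts G, on A :\: B | a].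
Proof.
move=> actA actB; apply/subsetP=> g Gg; rewrite !inE Gg /=.
by apply/subsetP=> x; rewrite !inE (acts_act actA) ?(acts_act actB).
Qed.

Lemma acts_orbit_in T (a : action G T) x : [acts G, on orbit a G x | a].
Proof.
apply/subsetP=> g Gg; rewrite !inE Gg /=; apply/subsetP=> _ /orbitP[h Gh <-].
by rewrite inE -actMin // mem_orbit // groupM.
Qed.

(** Induction on [#|A|], removing one orbit from each side. A point of [A] with largest stabilizer
    has a partner in [B] with the same label and stabilizer, hence with an isomorphic orbit. [f0]
    provides the function when [A] is empty. *)
Lemma crossed_fix_inj S T (X : crossed G S) (Y : crossed G T)
    (A : {set S}) (B : {set T}) (f0 : S -> T) :
  [acts G, on A | X] -> [acts G, on B | Y] ->
  (forall K a, K \subset G ->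
     #|A :&: crossed_fix X K a| = #|B :&: crossed_fix Y K a|) ->
  exists f, crossed_iso_on X Y A B f.
Proof.
have [n] := ubnP #|A|; elim: n => // n IHn in A B *.
rewrite ltnS => leAn actA actB eqAB.
have fix1 (U : finType) (Z : crossed G U) z : z \in crossed_fix Z 1%G (clabel Z z).
  by rewrite inE eqxx andbT; apply/afixP=> _ /set1P ->; rewrite act1.
have [A0|[x0 Ax0]] := set_0Vmem A.
  (* The trivial group fixes every point, so the counts there detect any point of [B]. *)
  have B0 : B = set0.
    apply/setP=> y; rewrite inE; apply/negP=> By.
    have /esym/eqP := eqAB 1%G (clabel Y y) (sub1G _).
    rewrite A0 set0I cards0 cards_eq0 => /eqP/setP/(_ y).
    by rewrite inE By fix1 inE.
  exists f0; rewrite A0 B0; split; try by move=> x; rewrite inE.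
  by rewrite imset0.
have sC (U : finType) (Z : crossed G U) z : 'C_G[z | Z]%G \subset G by apply: subsetIl.
have fixC (U : finType) (Z : crossed G U) z :
    z \in crossed_fix Z 'C_G[z | Z]%G (clabel Z z).
  by rewrite inE eqxx andbT; apply/afixP=> g; rewrite stabE => /andP[_ /eqP].
have transfer (K : {group gT}) x : K \subset G -> x \in A -> x \in 'Fix_X(K) ->
    exists2 y, y \in B & y \in crossed_fix Y K (clabel X x).
  move=> sKG Ax xK; have: (0 < #|B :&: crossed_fix Y K (clabel X x)|)%N.
    by rewrite -eqAB // card_gt0; apply/set0Pn; exists x; rewrite inE Ax inE xK eqxx.
  by rewrite card_gt0 => /set0Pn[y /setIP[]]; exists y.
have [x Ax max_x] := arg_maxnP (fun x => #|'C_G[x | X]|) Ax0.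
rewrite -[_ x]/(x \in A) in Ax.
have [|||y By] := transfer 'C_G[x | X]%G x => //.
  by have := fixC _ X x; rewrite inE => /andP[].
rewrite inE => /andP[/afixP xy /eqP eql].
have eqC : 'C_G[x | X] = 'C_G[y | Y].
  apply/eqP; rewrite eqEcard; apply/andP; split.
    by apply/subsetP=> g Cg; case/setIP: (Cg) => Gg _; rewrite stabE Gg xy /=.
  (* The equal counts at ['C_G[y | Y]] yield a point [x'] of [A] fixed by it; maximality of the
     stabilizer of [x] then bounds the order of ['C_G[y | Y]]. *)
  have: (0 < #|A :&: crossed_fix X 'C_G[y | Y]%G (clabel Y y)|)%N.
    by rewrite eqAB // card_gt0; apply/set0Pn; exists y; rewrite inE By fixC.
  rewrite card_gt0 => /set0Pn[x' /setIP[Ax']]; rewrite inE => /andP[/afixP x'y _].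
  apply: leq_trans (max_x x' Ax'); apply/subset_leq_card/subsetP=> g Cg.
  by case/setIP: (Cg) => Gg _; rewrite stabE Gg x'y /=.
have [f fxy] := crossed_orbit_iso eqC (esym eql).
have sxA := orbit_subset actA Ax; have syB := orbit_subset actB By.
have [|||K a sKG|f' f'AB] := IHn (A :\: orbit X G x) (B :\: orbit Y G y).
- apply: leq_trans leAn; rewrite (cardsD1 x A) Ax ltnS.
  apply/subset_leq_card/subsetP=> z; rewrite !inE => /andP[zx ->]; rewrite andbT.
  by apply: contraNneq zx => ->; apply: orbit_refl.
- exact/acts_setD/acts_orbit_in.
- exact/acts_setD/acts_orbit_in.
(* The counts on the two isomorphic orbits agree and cancel from the hypothesis. *)
- have splitI (U : finType) (C D F : {set U}) : D \subset C ->
      #|C :&: F| = (#|D :&: F| + #|(C :\: D) :&: F|)%N.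
    move=> sDC; rewrite -(cardsID D (C :&: F)) setIDAC; congr (_ + _)%N.
    by apply: eq_card => z; rewrite !inE andbAC; case: (boolP (z \in D)) => [/(subsetP sDC)->|];
      rewrite ?andbF.
  have := eqAB K a sKG; rewrite (splitI _ _ _ _ sxA) (splitI _ _ _ _ syB).
  by rewrite (crossed_iso_on_card a sKG (acts_orbit_in X x) fxy) => /addnI.
have disjD (U : finType) (C D : {set U}) : [disjoint C & D :\: C].
  by apply/pred0P=> z /=; rewrite inE; case: (z \in C).
have := crossed_iso_onU (acts_orbit_in X x) (disjD _ _ _) (disjD _ _ _) fxy f'AB.
have UD (U : finType) (C D : {set U}) : D \subset C -> D :|: C :\: D = C.
  by move=> sDC; rewrite -{1}(setIidPr sDC) setID.
by rewrite !UD //; eexists; eassumption.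
Qed.

End CrossedMarks.

(** * Marks of the crossed Burnside ring *)

Section CrossedMarkMatrix.
Variables (gT : finGroupType) (G : {group gT}).
Implicit Types (S T : finType) (K L : {group gT}).

(* The matrix, in the right regular representation, of the element
   [\sum_(x in X^K) clabel x] of the integral group ring. *)
Definition label_mx (K : {set gT}) T (X : crossed G T) : 'M[int]_#|gT| :=
  \matrix_(i, j) #|crossed_fix X K ((enum_val i)^-1 * enum_val j)%g|%:Z.

Lemma label_mx_iso S T (X : crossed G S) (Y : crossed G T) K :
  K \subset G -> crossed_iso X Y -> label_mx K X = label_mx K Y.
Proof.
by move=> sKG XY; apply/matrixP=> i j; rewrite !mxE (crossed_fix_iso _ sKG XY).
Qed.

Lemma label_mx_sum S T (X : crossed G S) (Y : crossed G T) K :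
  label_mx K (crossed_sum X Y) = label_mx K X + label_mx K Y.
Proof.
apply/matrixP=> i j; rewrite !mxE -PoszD; congr Posz.
rewrite -!sum1_card big_sumType /=; congr (_ + _)%N; apply: eq_bigl => x;
  rewrite !inE; congr (_ && _); apply/afixP/afixP => xK g Kg;
  by [case: (xK g Kg) | rewrite /= xK].
Qed.

(** Fixed points of a product are pairs of fixed points and their labels multiply, so the counts
    convolve as coefficients in the group ring. *)
Lemma label_mx_prod S T (X : crossed G S) (Y : crossed G T) K :
  label_mx K (crossed_prod X Y) = label_mx K X *m label_mx K Y.
Proof.
apply/matrixP=> i j; rewrite !mxE.
set a := ((enum_val i)^-1 * enum_val j)%g.
under eq_bigr do rewrite !mxE -PoszM.
rewrite -(big_morph Posz PoszD (erefl _)); congr Posz.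
(* With [enum_val k = enum_val i * b], the summand counts label [b] in [X] and label [b^-1 * a] in
   [Y]. *)
rewrite (reindex_onto (fun b => enum_rank (enum_val i * b)%g)
                      (fun k => (enum_val i)^-1 * enum_val k)%g) /=; last first.
  by move=> k _; rewrite mulKVg enum_valK.
rewrite (eq_bigl predT) => [|b]; last by rewrite enum_rankK mulKg eqxx.
rewrite -sum1_card (partition_big (fun u => clabel X u.1) predT) //=.
apply: eq_bigr => b _; rewrite enum_rankK mulKg invMg -mulgA -/a.
rewrite -cardsX -sum1_card; apply: eq_bigl => -[x y].
rewrite /= in_setX !crossed_fixE /=.
have ->: ((x, y) \in 'Fix_(crossed_prod X Y)(K)) =
         (x \in 'Fix_X(K)) && (y \in 'Fix_Y(K)).
  apply/afixP/andP => [xyK|[/afixP xK /afixP yK] g Kg]; last by rewrite /= xK ?yK.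
  by split; apply/afixP=> g Kg; case: (xyK g Kg).
case: (eqVneq (clabel X x) b) => [<-|_]; last by rewrite !(andbF, andFb).
by rewrite -(inj_eq (mulgI (clabel X x)^-1)%g) mulKg !andbT andbA.
Qed.

Definition crossed_count (K : {set gT}) (c : crossed_cls G) : 'M[int]_#|gT| :=
  label_mx K (tagged (crep c)).

Lemma crossed_countE T (X : crossed G T) K :
  K \subset G -> crossed_count K (ccls X) = label_mx K X.
Proof. by move=> sKG; apply: label_mx_iso sKG (crep_iso X). Qed.

Lemma crossed_countD K :
  K \subset G -> {morph crossed_count K : c d / c + d}.
Proof.
move=> sKG c d; rewrite -(crepK c) -(crepK d) [_ + _]ccls_addE !crossed_countE //.
exact: label_mx_sum.
Qed.

Lemma crossed_countM K :
  K \subset G -> {morph crossed_count K : c d / c * d}.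
Proof.
move=> sKG c d; rewrite -(crepK c) -(crepK d) [_ * _]ccls_mulE !crossed_countE //.
exact: label_mx_prod.
Qed.

Definition crossed_mark (K : {set gT}) : crossed_burnside G -> 'M[int]_#|gT| :=
  groth_ext (crossed_count K).

Lemma crossed_mark_zmod_morphism K : K \subset G -> zmod_morphism (crossed_mark K).
Proof. by move=> sKG; apply/groth_ext_zmod_morphism/crossed_countD. Qed.

Lemma crossed_markM K : K \subset G -> {morph crossed_mark K : x y / x * y}.
Proof.
by move=> sKG; apply: groth_extM; [apply: crossed_countD | apply: crossed_countM].
Qed.

Lemma crossed_markE T (X : crossed G T) K :
  K \subset G -> crossed_mark K (crossed_class X) = label_mx K X.
Proof.
by move=> sKG; rewrite /crossed_mark groth_ext_in ?crossed_countE //; apply: crossed_countD.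
Qed.

(** Each diagonal entry is the coefficient of the identity; this is the constant diagonal demanded
    by [idempotent_intmx_const_diag]. *)
Lemma crossed_mark_const_diag K x (i j : 'I_#|gT|) :
  crossed_mark K x i i = crossed_mark K x j j.
Proof. by rewrite !mxE !mulVg. Qed.

Lemma crossed_mark_class_inj S T (X : crossed G S) (Y : crossed G T) :
  (forall K : {group gT}, K \subset G -> label_mx K X = label_mx K Y) ->
  crossed_iso X Y.
Proof.
move=> eqXY; apply/crossed_iso_onT.
have eqK K a : K \subset G ->
    #|setT :&: crossed_fix X K a| = #|setT :&: crossed_fix Y K a|.
  move=> sKG; rewrite !setTI; have /matrixP := eqXY K sKG.
  (* The row of the identity lists the counts themselves, one column for each label. *)
  move/(_ (enum_rank 1%g) (enum_rank a)); rewrite !mxE !enum_rankK invg1 mul1g.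
  by case.
(* Equal counts at the trivial group give, for each point of [X], a point of [Y] with the same
   label. *)
have f0 : S -> T.
  move=> x; have: (0 < #|setT :&: crossed_fix Y 1%G (clabel X x)|)%N.
    rewrite -eqK ?sub1G // card_gt0; apply/set0Pn; exists x; rewrite setTI crossed_fixE eqxx.
    by rewrite andbT; apply/afixP=> _ /set1P ->; rewrite act1.
  rewrite card_gt0 => /set0Pn e; exact: xchoose e.
exact: crossed_fix_inj f0 (acts_full X) (acts_full Y) eqK.
Qed.

(** By additivity [x - y] can be treated as a difference of two classes whose matrices agree, which
    makes these classes isomorphic. *)
Lemma crossed_mark_inj (x y : crossed_burnside G) :
  (forall K : {group gT}, K \subset G -> crossed_mark K x = crossed_mark K y) ->
  x = y.
Proof.
move=> eqxy; apply/eqP; rewrite -subr_eq0.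
have: forall K : {group gT}, K \subset G -> crossed_mark K (x - y) = 0.
  by move=> K sKG; rewrite crossed_mark_zmod_morphism ?eqxy ?subrr.
elim/groth_ind: (x - y) => c d eqcd.
suff ->: c = d by rewrite subrr.
rewrite -(crepK c) -(crepK d); apply/cclsP/crossed_mark_class_inj => K sKG.
have := eqcd K sKG; rewrite crossed_mark_zmod_morphism // /crossed_mark.
by rewrite !groth_ext_in; [move/subr0_eq | apply: crossed_countD..].
Qed.

End CrossedMarkMatrix.

(** * Forgetting the labels *)

Section Forget.
Variables (gT : finGroupType) (G : {group gT}).
Implicit Types (T : finType) (K L : {group gT}).

Definition forget_cls (c : crossed_cls G) : burnside G :=
  burnside_class (tagged (crep c)).

Lemma forget_clsE T (X : crossed G T) : forget_cls (ccls X) = burnside_class X.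
Proof.
congr groth_in; apply/gclsP; have [f fB [fG _]] := crep_iso X.
by exists f.
Qed.

Lemma forget_clsD : {morph forget_cls : c d / c + d}.
Proof.
move=> c d; rewrite -(crepK c) -(crepK d) [_ + _]ccls_addE !forget_clsE.
by rewrite -groth_inD [_ + _]gcls_addE.
Qed.

Lemma forget_clsM : {morph forget_cls : c d / c * d}.
Proof.
move=> c d; rewrite -(crepK c) -(crepK d) [_ * _]ccls_mulE !forget_clsE.
by rewrite -groth_inM [_ * _]gcls_mulE.
Qed.

Definition forget : crossed_burnside G -> burnside G := groth_ext forget_cls.

Lemma forget_zmod_morphism : zmod_morphism forget.
Proof. exact/groth_ext_zmod_morphism/forget_clsD. Qed.

Lemma forgetM : {morph forget : x y / x * y}.
Proof. by apply: groth_extM; [apply: forget_clsD | apply: forget_clsM]. Qed.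

Lemma forget_class T (X : crossed G T) : forget (crossed_class X) = burnside_class X.
Proof. by rewrite /forget groth_ext_in ?forget_clsE //; apply: forget_clsD. Qed.

Lemma crossed_iota_clsM : {morph @crossed_iota_cls gT G : X Y / X * Y}.
Proof.
move=> X Y; rewrite -(grepK X) -(grepK Y) [_ * _]gcls_mulE !crossed_iota_clsE.
rewrite -groth_inM [_ * _]ccls_mulE; congr groth_in.
apply/cclsP; exists id; first by exists id.
by split=> // u /=; rewrite mulg1.
Qed.

Lemma crossed_iotaM : {morph @crossed_iota gT G : x y / x * y}.
Proof. by apply: groth_extM; [apply: crossed_iota_clsD | apply: crossed_iota_clsM]. Qed.

Lemma crossed_iotaK : cancel (@crossed_iota gT G) (@forget).
Proof.
elim/groth_ind=> X Y; rewrite -(grepK X) -(grepK Y).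
rewrite crossed_iota_zmod_morphism forget_zmod_morphism !crossed_iota_class.
by rewrite !forget_class.
Qed.

(** With all labels trivial, the associated group ring element is a multiple of the identity. *)
Lemma crossed_mark_iota K (y : burnside G) :
  K \subset G -> crossed_mark K (crossed_iota y) = (mark K y)%:M.
Proof.
move=> sKG; elim/groth_ind: y => X Y; rewrite -(grepK X) -(grepK Y).
rewrite crossed_iota_zmod_morphism crossed_mark_zmod_morphism // mark_zmod_morphism //.
rewrite [RHS]raddfB /= !crossed_iota_class !crossed_markE // !markE //.
have E T (a : action G T) : label_mx K (crossed_const a) = #|'Fix_a(K)|%:Z%:M.
  apply/matrixP=> i j; rewrite !mxE -(inj_eq enum_val_inj i j) eq_mulVg1.
  case: eqVneq => [->|ne]; last first.
    rewrite mulr0n; apply/eqP; rewrite eqz_nat cards_eq0; apply/eqP/setP=> x.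
    by rewrite crossed_fixE eq_sym (negPf ne) andbF inE.
  by rewrite mulr1n; congr Posz; apply: eq_card => x; rewrite crossed_fixE eqxx andbT.
by rewrite !E.
Qed.

(** Forgetting labels corresponds to the augmentation of the group ring, visible in the regular
    representation as the sum of any row. *)
Lemma mark_forget K x (i : 'I_#|gT|) : K \subset G ->
  mark K (forget x) = \sum_j crossed_mark K x i j.
Proof.
move=> sKG; elim/groth_ind: x => c d; rewrite -(crepK c) -(crepK d).
rewrite forget_zmod_morphism crossed_mark_zmod_morphism // mark_zmod_morphism //.
have mxB (A B : 'M[int]_#|gT|) j : (A - B) i j = A i j - B i j by rewrite !mxE.
under eq_bigr do rewrite mxB; rewrite sumrB.
have E T (X : crossed G T) : mark K (forget (crossed_class X)) =
    \sum_j crossed_mark K (crossed_class X) i j.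
  rewrite forget_class markE // crossed_markE //.
  under eq_bigr do rewrite mxE; rewrite -(big_morph Posz PoszD (erefl _)).
  congr Posz; rewrite -sum1_card.
  rewrite (partition_big (fun x => enum_rank (enum_val i * clabel X x)%g) predT) //=.
  apply: eq_bigr => j _; rewrite -sum1_card; apply: eq_bigl => x.
  rewrite crossed_fixE (can2_eq (@enum_rankK _) (@enum_valK _)).
  by congr (_ && _); rewrite -[RHS](inj_eq (mulgI (enum_val i))) mulKVg.
by rewrite !E.
Qed.

(** Each matrix [crossed_mark K x] is idempotent with constant diagonal, hence 0 or 1. Such a scalar
    matrix is recovered from a row sum, that is, from the mark of [forget x] at [K]. *)
Lemma crossed_idempotent_iota (x : crossed_burnside G) :
  x * x = x -> crossed_iota (forget x) = x.
Proof.
move=> xx; apply: crossed_mark_inj => K sKG; rewrite crossed_mark_iota //.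
have i : 'I_#|gT| := enum_rank 1%g.
rewrite (mark_forget x i) //.
have P2 : crossed_mark K x *m crossed_mark K x = crossed_mark K x.
  by rewrite -[LHS]crossed_markM ?xx.
have [->|->] := idempotent_intmx_const_diag P2 (crossed_mark_const_diag K x ^~ i).
  by rewrite big1 ?raddf0 // => j _; rewrite mxE.
congr (_%:M); rewrite (bigD1 i) //= big1 => [|j ne]; rewrite mxE ?eqxx ?addr0 //.
by rewrite eq_sym (negPf ne).
Qed.

End Forget.

(** * Marks of the Burnside ring *)

Section BurnsideMarks.
Variables (gT : finGroupType) (G : {group gT}).
Implicit Types (T : finType) (H K L : {group gT}) (y : burnside G).

Lemma mark_inj y z :
  (forall K, K \subset G -> mark K y = mark K z) -> y = z.
Proof.
move=> eqyz; apply: (can_inj (@crossed_iotaK _ _)); apply: crossed_mark_inj => K sKG.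
by rewrite !crossed_mark_iota // eqyz.
Qed.

Lemma fixcountM K :
  K \subset G -> {morph @fixcount gT G K : X Y / X * Y}.
Proof.
move=> sKG X Y; rewrite -(grepK X) -(grepK Y) [_ * _]gcls_mulE !fixcountE //.
rewrite -PoszM -cardsX; congr Posz; apply: eq_card => -[x y]; rewrite in_setX /=.
apply/afixP/andP => [xyK|[/afixP xK /afixP yK] g Kg]; last by rewrite /= xK ?yK.
by split; apply/afixP=> g Kg; case: (xyK g Kg).
Qed.

Lemma markM K y z : K \subset G -> mark K (y * z) = mark K y * mark K z.
Proof.
by move=> sKG; rewrite [LHS]groth_extM; [| apply: fixcountD | apply: fixcountM].
Qed.

Lemma burnside_class_ind (P : burnside G -> Prop) :
  (forall n (a : action G 'I_n), P (burnside_class a)) ->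
  (forall y z, P y -> P z -> P (y - z)) -> forall y, P y.
Proof.
move=> Pa PB; elim/groth_ind=> X Y; rewrite -(grepK X) -(grepK Y).
by apply: PB; apply: Pa.
Qed.

Lemma markJ K g y : K \subset G -> g \in G -> mark (K :^ g) y = mark K y.
Proof.
move=> sKG Gg; have sKgG : K :^ g \subset G by rewrite -(conjGid Gg) conjSg.
elim/burnside_class_ind: y => [n a|y z]; last first.
  by rewrite !mark_zmod_morphism // => -> ->.
rewrite !(@markE _ _ [group of K :^ g], markE) //; congr Posz.
have <-: a^~ g @: 'Fix_a(K) = 'Fix_a(K :^ g).
  apply/setP=> x; apply/imsetP/afixP => [[z /afixP zK ->] h|xK].
    case/imsetP=> k Kk ->; have Gk := subsetP sKG k Kk.
    by rewrite -actMin ?groupJ // -conjgC actMin // zK.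
  exists (a x g^-1%g); last by rewrite -actMin ?groupV // mulVg act1.
  apply/afixP=> k Kk; have Gk := subsetP sKG k Kk.
  have := xK (k ^ g)%g; rewrite memJ_conjg => /(_ Kk).
  by rewrite conjgE !actMin ?groupM ?groupV // => /(canRL (actKin _ Gg)).
by rewrite card_imset //; apply: act_inj.
Qed.

(** Cauchy-Frobenius for [L] acting on the [K]-fixed points of a [G]-set: those fixed by [g] are the
    fixed points of [K <*> <[g]>], so the sum is [#|L|] times the number of orbits. Additivity
    extends this to differences. *)
Lemma dvdz_sum_mark K L y : K <| L -> L \subset G ->
  (#|L| %| \sum_(g in L) mark (K <*> <[g]>)%G y)%Z.
Proof.
move=> nKL sLG; have [sKL nKL'] := andP nKL; have sKG := subset_trans sKL sLG.
have sKgG g : g \in L -> (K <*> <[g]>)%G \subset G.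
  by move=> Lg; rewrite join_subG sKG cycle_subG (subsetP sLG).
elim/burnside_class_ind: y => [n a|y z dy dz]; last first.
  rewrite (eq_bigr (fun g => mark (K <*> <[g]>)%G y - mark (K <*> <[g]>)%G z)).
    by rewrite sumrB rpredB.
  by move=> g Lg; rewrite mark_zmod_morphism // sKgG.
rewrite (eq_bigr (fun g => Posz #|'Fix_('Fix_a(K) | a)[g]|)); last first.
  move=> g Lg; rewrite markE ?sKgG //; congr Posz; apply: eq_card => x.
  apply/afixP/setIP => [xKg|[/afixP xK /afixP xg] h].
    split; apply/afixP=> h; first by move=> Kh; apply: xKg; rewrite mem_gen // inE Kh.
    by move/set1P->; apply: xKg; rewrite mem_gen // inE cycle_id orbT.
  suff: K <*> <[g]> \subset 'C_G[x | a] by move/subsetP/[apply]; rewrite stabE => /andP[_ /eqP].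
  rewrite join_subG cycle_subG stabE (subsetP sLG) //= xg ?set11 // eqxx andbT.
  by apply/subsetP=> k Kk; rewrite stabE (subsetP sKG) //= xK.
rewrite -(big_morph Posz PoszD (erefl _)) Frobenius_Cauchy ?PoszM ?dvdz_mull //.
(* [L] stabilizes the set of [K]-fixed points because it normalizes [K]. *)
apply/subsetP=> g Lg; have Gg := subsetP sLG g Lg; rewrite inE Gg inE.
apply/subsetP=> x /afixP xK; rewrite inE; apply/afixP=> k Kk.
have Kkg : (k ^ g^-1)%g \in K by rewrite memJ_norm // groupV (subsetP nKL').
have [Gk Gkg] := (subsetP sKG k Kk, subsetP sKG _ Kkg).
by rewrite -actMin // conjgCV actMin // xK.
Qed.

Lemma gset_coset_fix H K (A : coset_space G H) x : K \subset G -> x \in G ->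
  val A = H :* x -> (A \in 'Fix_(gset_coset G H)(K)) = (K \subset H :^ x).
Proof.
move=> sKG Gx eA.
have E k : k \in K -> (gset_coset G H A k == A) = (k \in H :^ x).
  move=> Kk; rewrite -val_eqE coset_mulE ?(subsetP sKG) // eA -rcosetM.
  by rewrite (sameP eqP rcoset_eqP) mem_rcoset mem_conjg conjgE invgK mulgA.
by apply/afixP/subsetP => AK k Kk; [rewrite -E // AK | apply/eqP; rewrite E ?AK].
Qed.

Lemma coset_space_val H (A : coset_space G H) :
  exists2 x, x \in G & val A = H :* x.
Proof. by case/rcosetsP: (valP A) => x; exists x. Qed.

Lemma mark_gset_coset_neq0 H K : H \subset G -> K \subset G ->
  mark K (burnside_class (gset_coset G H)) != 0 ->
  exists2 x, x \in G & K \subset H :^ x.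
Proof.
move=> sHG sKG; rewrite markE // eqz_nat cards_eq0 => /set0Pn[A].
have [x Gx eA] := coset_space_val A.
by rewrite (gset_coset_fix sKG Gx eA); exists x.
Qed.

(** A coset [H :* x] is fixed by [H] exactly when [H] lies in [H :^ x]; equality of orders then
    makes [x] normalize [H]. *)
Lemma mark_gset_coset_self H : H \subset G ->
  mark H (burnside_class (gset_coset G H)) = #|'N_G(H) : H|.
Proof.
move=> sHG; rewrite markE //; congr Posz.
rewrite /indexg -(card_imset _ val_inj); apply: eq_card => A.
apply/imsetP/rcosetsP => [[B BH ->]|[x /setIP[Gx Nx] ->]].
  have [x Gx eB] := coset_space_val B; exists x => //.
  rewrite (gset_coset_fix sHG Gx eB) in BH.
  have /eqP e : H :==: H :^ x by rewrite eqEcard BH cardJg leqnn.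
  by apply/setIP; split=> //; apply/normP.
have AG : H :* x \in rcosets H G by apply/rcosetsP; exists x.
exists (Sub (H :* x) AG); last by rewrite SubK.
by rewrite (gset_coset_fix (x := x)) ?SubK // (normP Nx).
Qed.

End BurnsideMarks.

(** * Realizing functions on subgroups as marks *)

Section GhostRing.
Variables (gT : finGroupType) (G : {group gT}).
Implicit Types (H K L M : {group gT}).

Lemma conj_subgroupsP H K :
  reflect (exists2 g, g \in G & H = (K :^ g)%G) (conj_subgroups G H K).
Proof. by apply: (iffP orbitP) => [] [g Gg] e; exists g. Qed.

Lemma conj_subgroups_refl H : conj_subgroups G H H.
Proof. exact: orbit_refl. Qed.

Lemma conj_subgroups_sym H K : conj_subgroups G H K = conj_subgroups G K H.
Proof. by rewrite /conj_subgroups orbit_sym. Qed.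

Lemma conj_subgroups_trans H K L :
  conj_subgroups G H K -> conj_subgroups G K L -> conj_subgroups G H L.
Proof. exact: orbit_trans. Qed.

Lemma conj_subgroupsJ K g : g \in G -> conj_subgroups G (K :^ g)%G K.
Proof. by move=> Gg; apply/conj_subgroupsP; exists g. Qed.

Lemma mark_conj H K (y : burnside G) :
  K \subset G -> conj_subgroups G H K -> mark H y = mark K y.
Proof. by move=> sKG /conj_subgroupsP[g Gg ->]; apply: markJ. Qed.

Lemma mark0 K : K \subset G -> mark K (0 : burnside G) = 0.
Proof. by move=> sKG; apply/zmod_morphism0/mark_zmod_morphism. Qed.

(** Marks satisfy these, by [dvdz_sum_mark] with [L = 'N_G(K)]; together with invariance under
    conjugation they characterize marks. *)
Definition ghost_congruences (m : {group gT} -> int) :=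
  forall K, K \subset G ->
    (#|'N_G(K)| %| \sum_(g in 'N_G(K)) m (K <*> <[g]>)%G)%Z.

(* The marks of [G/K] vanish outside the subgroups subconjugate to K, and at a
   subgroup K maximal in the support of [m] the congruence says exactly that
   [m K] is a multiple of the mark [|N_G(K) : K|] of [G/K] at K. *)
Lemma ghost_lift (m : {group gT} -> int) :
  (forall K g, K \subset G -> g \in G -> m (K :^ g)%G = m K) ->
  ghost_congruences m ->
  exists y : burnside G, forall K, K \subset G -> mark K y = m K.
Proof.
(* The induction is on the size of a family containing the support of the function, stable under
   subgroups and under conjugation by [G]. *)
pose closed (A : {set {group gT}}) :=
  [/\ forall L, L \in A -> L \subset G,
      forall L M, L \in A -> M \subset L -> M \in A &
      forall L g, L \in A -> g \in G -> (L :^ g)%G \in A].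
suff main n (A : {set {group gT}}) (f : {group gT} -> int) :
    (#|A| < n)%N -> closed A -> (forall L, L \subset G -> L \notin A -> f L = 0) ->
    (forall K g, K \subset G -> g \in G -> f (K :^ g)%G = f K) ->
    ghost_congruences f ->
    exists y : burnside G, forall K, K \subset G -> mark K y = f K.
  apply: (main _ [set L : {group gT} | L \subset G] _ (leqnn _)); last first.
    by move=> L sLG; rewrite inE sLG.
  split=> [L|L M|L g]; rewrite !inE //; first by move=> sLG sML; apply: subset_trans sLG.
  by move=> sLG Gg; rewrite -(conjGid Gg) conjSg.
elim: n => // n IHn in A f *; rewrite ltnS => leAn [sA clA JA] f0 fJ f_dvd.
have [A0|[K0 AK0]] := set_0Vmem A.
  by exists 0 => K sKG; rewrite mark0 // f0 // A0 inE.
have [K AK max_K] := arg_maxnP (fun K : {group gT} => #|K|) AK0.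
rewrite -[_ K]/(K \in A) in AK; have sKG := sA K AK.
have KNK : K \subset 'N_G(K) by rewrite subsetI sKG normG.
have dvdK : (#|'N_G(K) : K| %| f K)%Z.
  (* For [g] outside [K], the group [K <*> <[g]>] is larger than every member of [A], so its term
     vanishes; the other [#|K|] terms equal [f K]. *)
  have := f_dvd K sKG; rewrite (big_setID K) /= (setIidPr KNK).
  rewrite [X in _ + X]big1 => [|g /setDP[/setIP[Gg Ng] nKg]]; last first.
    apply: f0; first by rewrite join_subG sKG cycle_subG.
    apply: contra nKg => /max_K /= leK; rewrite -cycle_subG.
    have: K :==: (K <*> <[g]>) by rewrite eqEcard joing_subl.
    by move/eqP->; rewrite joing_subr.
  rewrite addr0 (eq_bigr (fun=> f K)) => [|g Kg]; last first.
    congr f; apply: val_inj => /=; apply/joing_idPl; by rewrite cycle_subG.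
  rewrite sumr_const -mulr_natl -(Lagrange KNK) PoszM natz dvdz_mul2l //.
  by rewrite eqz_nat -lt0n.
have /dvdzP[c fK] := dvdK.
pose b := burnside_class (gset_coset G K).
have mark_b L : L \subset G -> mark L (b *~ c) = c * mark L b.
  move=> sLG; rewrite zmod_morphismMz; last exact: mark_zmod_morphism.
  by rewrite -mulrzr mulrC intz.
(* Subtracting [c] times the class of [G/K] kills the function on the conjugates of [K], which then
   leave the family. *)
pose A' := [set L in A | ~~ conj_subgroups G L K].
have maxA L : L \in A -> (#|L| <= #|K|)%N by apply: max_K.
have [||L sLG||M|y yP] := IHn A' (fun L => f L - mark L (b *~ c)).
- apply: leq_trans leAn; apply/proper_card/properP; split.
    by apply/subsetP=> L; rewrite inE => /andP[].
  by exists K; rewrite // inE conj_subgroups_refl andbF.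
- split=> [L|L M|L g]; rewrite !inE.
  + by case/andP=> /sA.
  + case/andP=> AL nLK sML; rewrite (clA L) //=; apply: contra nLK => MK.
    suff <- : M = L by [].
    case/conj_subgroupsP: MK => g Gg eM; apply/val_inj/eqP.
    by rewrite eqEcard sML eM /= cardJg maxA.
  + case/andP=> AL nLK Gg; rewrite JA //=; apply: contra nLK.
    by apply: conj_subgroups_trans; rewrite conj_subgroups_sym conj_subgroupsJ.
- rewrite inE negb_and negbK => /orP[nAL|LK].
    (* A nonzero mark of [G/K] at [L] would put [L] inside a conjugate of [K], hence in [A]. *)
    rewrite f0 // sub0r mark_b //.
    case: (eqVneq (mark L b) 0) => [->|]; first by rewrite mulr0 oppr0.
    case/mark_gset_coset_neq0=> // x Gx sLK; case/negP: nAL.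
    exact: clA (JA K x AK Gx) sLK.
  rewrite mark_b // (mark_conj _ sKG LK) mark_gset_coset_self // -fK.
  by case/conj_subgroupsP: LK => g Gg ->; rewrite fJ ?subrr.
- by move=> L g sLG Gg; rewrite fJ // markJ.
- move=> sMG; rewrite sumrB rpredB ?f_dvd // dvdz_sum_mark ?subsetIl //.
  by rewrite /normal subsetI sMG normG subsetIr.
exists (y + b *~ c) => L sLG.
by rewrite (zmod_morphismD (mark_zmod_morphism sLG)) yP // subrK.
Qed.

End GhostRing.

(** * Solvable residuals *)

Section SolvableResidual.
Variable gT : finGroupType.
Implicit Types (H K L N : {group gT}).

Lemma solvable_quotientP N K :
  N <| K -> reflect (exists n, K^`(n)%g \subset N) (solvable (K / N)%g).
Proof.
move=> nNK; have nNKn n := subset_trans (der_sub n K) (normal_norm nNK).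
apply: (iffP (derivedP _)) => -[n sKN]; exists n; move: sKN; rewrite -quotient_der ?normal_norm //.
  by move/trivgP; rewrite /= quotient_sub1.
by move=> sKN; apply/trivgP; rewrite /= quotient_sub1.
Qed.

Lemma sol_residualJ_sub K g : sol_residual (K :^ g)%G \subset sol_residual K :^ g.
Proof.
have [nR /solvable_quotientP-/(_ nR)[n sKR] _] := sol_residualP K.
have [_ _ minR] := sol_residualP (K :^ g)%G.
apply: (minR (sol_residual K :^ g)%G); first by rewrite normalJ.
by apply/solvable_quotientP; rewrite ?normalJ //; exists n; rewrite derJ conjSg.
Qed.

Lemma sol_residualJ K g : sol_residual (K :^ g)%G = (sol_residual K :^ g)%G.
Proof.
apply/val_inj/eqP; rewrite eqEsubset sol_residualJ_sub /=.
rewrite sub_conjg; have := sol_residualJ_sub (K :^ g)%G g^-1%g.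
by have ->: ((K :^ g) :^ g^-1)%G = K by apply/val_inj/conjsgK.
Qed.

Lemma sol_residual_sub K : sol_residual K \subset K.
Proof. by have [/normal_sub] := sol_residualP K. Qed.

(** The residual of [K] is normal in [L], and [L] modulo it is an extension of solvable groups;
    conversely the residual of [L] lies in [K] with solvable quotient. Minimality gives both
    inclusions. *)
Lemma sol_residual_normal K L :
  K <| L -> solvable (L / K)%g -> sol_residual L = sol_residual K.
Proof.
move=> nKL solLK; have [sKL nKL'] := andP nKL.
have [nRL solL minL] := sol_residualP L; have [nRK solK minK] := sol_residualP K.
have sRLK := minL K nKL solLK.
have nRKL : sol_residual K <| L.
  rewrite /normal (subset_trans (sol_residual_sub K)) //=.
  apply/subsetP=> g Lg; rewrite inE.
  have eK : (K :^ g)%G = K by apply/val_inj/normP/(subsetP nKL').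
  by have := sol_residualJ K g; rewrite eK => /(congr1 val)/= <-.
apply/val_inj/eqP; rewrite eqEsubset; apply/andP; split; last first.
  apply: minK; first exact: normalS sRLK sKL nRL.
  by apply: solvableS solL; apply: quotientS.
apply: minL => //.
have [n sLK] := solvable_quotientP nKL solLK; have [m sKR] := solvable_quotientP nRK solK.
(* Derived subgroup [n] of [L] lies in [K], so derived subgroup [m + n] of [L] lies in derived
   subgroup [m] of [K]. *)
apply/solvable_quotientP => //; exists (m + n)%N; apply: subset_trans sKR.
by elim: m => [|m IHm]; rewrite ?add0n // addSn !dergSn commgSS.
Qed.

Lemma sol_residual_id K : sol_residual (sol_residual K) = sol_residual K.
Proof.
by have [nR sR _] := sol_residualP K; rewrite -(sol_residual_normal nR sR).
Qed.

(** A perfect group equals all its derived subgroups, so its solvable quotients are trivial;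
    conversely the abelianization is solvable, so the residual lies in the commutator subgroup. *)
Lemma perfectE K : perfect K = (sol_residual K == K).
Proof.
have [nR sR minR] := sol_residualP K; apply/eqP/eqP => [pK|eK].
  apply/val_inj/eqP; rewrite eqEsubset normal_sub //=.
  have [n] := solvable_quotientP nR sR.
  suff ->: K^`(n)%g = K by [].
  by elim: n => [|n IHn]; rewrite ?derg0 // dergSn IHn.
apply/eqP; rewrite eqEsubset der1_subG -{1}eK; apply: (minR (K^`(1))%G).
  exact: der_normal.
by apply: abelian_sol; apply: der_abelian 0 K.
Qed.

Lemma sol_residual_perfect K : perfect (sol_residual K).
Proof. by rewrite perfectE sol_residual_id. Qed.

End SolvableResidual.

(** * Idempotents *)

Lemma idempotent_idomain (R : idomainType) (a : R) : a * a = a -> a = 0 \/ a = 1.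
Proof.
move=> aa; have /eqP: a * (a - 1) = 0 by rewrite mulrBr aa mulr1 subrr.
by rewrite mulf_eq0 subr_eq0 => /orP[] /eqP; [left | right].
Qed.

Lemma dvdz_mulrn (c : int) d n : (d %| n)%N -> (d %| c *+ n)%Z.
Proof. by case/dvdnP=> k ->; rewrite mulrnA -mulr_natr natz dvdz_mull. Qed.

(** The sum is [b * (n * p) + (a - b) * n]. It arises from the congruence for a normal subgroup of
    order [n] and index [p]. *)
Lemma dvdz_weighted_sum (a b : int) n p : (0 < n)%N -> (0 < p)%N ->
  ((n * p)%N %| a *+ n + b *+ (n * p - n))%Z -> (p %| a - b)%Z.
Proof.
move=> n_gt0 p_gt0; rewrite mulrnBr ?leq_pmulr // addrCA -mulrnBl.
have eM (c : int) k : c *+ k = k%:Z * c by rewrite -mulr_natl natz.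
rewrite !eM rpredDl; last exact: dvdz_mulr.
by rewrite PoszM dvdz_mul2l // eqz_nat -lt0n.
Qed.

Lemma intr_div_eq (a b : int) n m :
  a%:~R / n.+1%:R = b%:~R / m.+1%:R :> rat -> a *+ m.+1 = b *+ n.+1.
Proof.
move/eqP; rewrite eqr_div ?pnatr_eq0 // !mulr_natr -!rmorphMn /= => /eqP.
exact: intr_inj.
Qed.

Section BurnsideIdempotents.
Variables (gT : finGroupType) (G : {group gT}).
Implicit Types (H J K L N : {group gT}) (y z f : burnside G).

Lemma mark_idempotent y K : y * y = y -> K \subset G -> mark K y = 0 \/ mark K y = 1.
Proof. by move=> yy sKG; apply: idempotent_idomain; rewrite -markM ?yy. Qed.

Lemma prime_index_joing N K g : N <| K -> prime #|K : N| -> g \in K :\: N ->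
  (N <*> <[g]>)%G = K.
Proof.
move=> nNK prKN /setDP[Kg nNg]; have sNK := normal_sub nNK.
have sMK : N <*> <[g]> \subset K by rewrite join_subG sNK cycle_subG.
apply/val_inj/eqP; rewrite eqEsubset sMK /= -indexg_eq1.
have := Lagrange_index sMK (joing_subl N <[g]>) => e.
have: (#|N <*> <[g]> : N| %| #|K : N|)%N by rewrite -e dvdn_mull.
case/primeP: (prKN) => _ prK /prK/orP[|/eqP eN].
  by rewrite (@indexg_eq1 _ (N <*> <[g]>)%G) /= join_subG cycle_subG (negPf nNg) andbF.
by rewrite -(eqn_pmul2r (prime_gt0 prKN)) mul1n -{2}e eN.
Qed.

(** Every [g] in [K] outside [N] generates [K] together with [N], so the congruence makes the two
    marks equal modulo the index; both are 0 or 1. *)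
Lemma mark_idempotent_prime_index y N K :
  y * y = y -> N <| K -> K \subset G -> prime #|K : N| -> mark K y = mark N y.
Proof.
move=> yy nNK sKG prKN; have sNK := normal_sub nNK; have sNG := subset_trans sNK sKG.
have := dvdz_sum_mark y nNK sKG; rewrite (big_setID N) /= (setIidPr sNK).
rewrite (eq_bigr (fun=> mark N y)) => [|g Ng]; last first.
  by congr mark; apply/joing_idPl; rewrite cycle_subG.
rewrite [X in _ + X](eq_bigr (fun=> mark K y)) => [|g KNg]; last first.
  by have /(congr1 val)/= -> := prime_index_joing nNK prKN KNg.
rewrite !sumr_const cardsD (setIidPr sNK) -(Lagrange sNK).
move/(dvdz_weighted_sum (cardG_gt0 N) (prime_gt0 prKN)).
have [p_gt1 _] := primeP prKN.
case: (mark_idempotent yy sKG) => ->; case: (mark_idempotent yy sNG) => -> //;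
  by rewrite ?subr0 ?sub0r dvdzE /= dvdn1 => /eqP p1; rewrite p1 in p_gt1.
Qed.

(** A nontrivial solvable quotient has a normal subgroup of prime index. Passing to its preimage in
    [K] changes neither the mark nor the residual, so induction on the order applies. *)
Lemma mark_sol_residual y K :
  y * y = y -> K \subset G -> mark (sol_residual K) y = mark K y.
Proof.
move=> yy; have [n] := ubnP #|K|; elim: n => // n IHn in K *; rewrite ltnS => leKn sKG.
have [nR sR _] := sol_residualP K.
have [q1|ntq] := eqVneq (K / sol_residual K)%g 1%g.
  congr mark; apply/eqP; rewrite eqEsubset normal_sub //=.
  by rewrite -quotient_sub1 ?normal_norm // q1.
have [Nbar nNbar prN] := sol_prime_factor_exists sR ntq.
have [N eN sRN nNK] := inv_quotientN nR nNbar.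
have sNK := normal_sub nNK.
have prKN : prime #|K : N|.
  rewrite eN index_quotient_eq ?(normal_norm nR) // in prN.
  by rewrite (subset_trans (subsetIr _ _)).
rewrite (mark_idempotent_prime_index yy nNK) //.
have solKN : solvable (K / N)%g.
  apply/abelian_sol/cyclic_abelian/prime_cyclic.
  by rewrite card_quotient // normal_norm.
rewrite (sol_residual_normal nNK solKN) IHn ?(subset_trans sNK) //.
apply: leq_trans leKn; rewrite -(Lagrange sNK) ltn_Pmulr ?cardG_gt0 //.
by rewrite prime_gt1.
Qed.

Lemma conj_sol_residual H K :
  conj_subgroups G H K -> conj_subgroups G (sol_residual H) (sol_residual K).
Proof.
by case/conj_subgroupsP=> g Gg ->; rewrite sol_residualJ conj_subgroupsJ.
Qed.

(** The marks of [f^G_J], stated without a choice of representatives. *)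
Definition dress_marks J f :=
  forall K, K \subset G -> mark K f = (conj_subgroups G (sol_residual K) J)%:R.

(** For [g] normalizing [K], the quotient of [K <*> <[g]>] by [K] is cyclic, so the residual does
    not depend on [g] and all summands of the congruence are equal. This is the integrality in
    Dress's theorem. *)
Lemma dress_marks_exists J : exists f, dress_marks J f.
Proof.
apply: (@ghost_lift _ G (fun K => (conj_subgroups G (sol_residual K) J)%:R)).
  move=> K g sKG Gg; congr (_ _)%:R; apply/idP/idP; apply: conj_subgroups_trans.
    by rewrite sol_residualJ conj_subgroups_sym conj_subgroupsJ.
  by rewrite sol_residualJ conj_subgroupsJ.
move=> K sKG; rewrite (eq_bigr (fun=> (conj_subgroups G (sol_residual K) J)%:R)).
  by rewrite sumr_const dvdz_mulrn.
move=> g /setIP[Gg Ng]; rewrite (@sol_residual_normal _ K (K <*> <[g]>)%G) //.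
  by rewrite /normal joing_subl join_subG normG cycle_subG.
rewrite quotientYidl ?cycle_subG //; apply/abelian_sol/cyclic_abelian.
exact/quotient_cyclic/cycle_cyclic.
Qed.

Lemma dress_marks_inj J f f' : dress_marks J f -> dress_marks J f' -> f = f'.
Proof. by move=> fJ f'J; apply: mark_inj => K sKG; rewrite fJ ?f'J. Qed.

Lemma idempotent_eq0 y : y * y = y ->
  (forall J, J \subset G -> perfect J -> mark J y = 0) -> y = 0.
Proof.
move=> yy y0; apply: mark_inj => K sKG; rewrite mark0 // -mark_sol_residual //.
by rewrite y0 ?sol_residual_perfect // (subset_trans (sol_residual_sub K)).
Qed.

Lemma perfect_id J : perfect J -> sol_residual J = J.
Proof. by rewrite perfectE => /eqP. Qed.

Lemma dress_marks_perfect J f K : perfect K -> K \subset G -> dress_marks J f ->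
  mark K f = (conj_subgroups G K J)%:R.
Proof. by move=> pK sKG ->; rewrite ?perfect_id. Qed.

Lemma dress_marks_idempotent J f : dress_marks J f -> f * f = f.
Proof.
by move=> fJ; apply: mark_inj => K sKG; rewrite markM ?fJ // -natrM mulnb andbb.
Qed.

(** Among perfect subgroups only the conjugates of [J] carry a nonzero mark of [f]. In an orthogonal
    decomposition one summand has mark 0 at [J], and then at every perfect subgroup. *)
Lemma dress_marks_primitive J f :
  J \subset G -> perfect J -> dress_marks J f -> primitive_idempotent f.
Proof.
move=> sJG pJ fJ; have ff := dress_marks_idempotent fJ.
split=> // [f0|a b aa bb ab _ fab].
  have := dress_marks_perfect pJ sJG fJ.
  by rewrite f0 mark0 // conj_subgroups_refl.
have fD K : K \subset G -> mark K f = mark K a + mark K b.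
  by move=> sKG; rewrite fab (zmod_morphismD (mark_zmod_morphism sKG)).
suff vanish (c d : burnside G) : c * c = c -> d * d = d ->
    (forall K, K \subset G -> mark K f = mark K c + mark K d) -> mark J c = 0 -> c = 0.
  have : mark J a * mark J b = 0 by rewrite -markM // ab mark0.
  move/eqP; rewrite mulf_eq0 => /orP[]/eqP J0; [left|right].
    exact: vanish aa bb fD J0.
  by apply: vanish bb aa _ J0 => K sKG; rewrite addrC fD.
move=> cc dd fcd cJ; apply: idempotent_eq0 => // K sKG pK.
have := fcd K sKG; rewrite (dress_marks_perfect pK sKG fJ).
have [KJ _|_] := boolP (conj_subgroups G K J); first by rewrite (mark_conj c sJG KJ).
(* Two marks that are 0 or 1 and have sum 0 both vanish. *)
by case: (mark_idempotent cc sKG) => -> //; case: (mark_idempotent dd sKG) => ->.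
Qed.

(** A nonzero idempotent has mark 1 at some perfect [J]. Then [y * f = f] for the [f] attached to
    [J], and primitivity applied to [y = f + (y - f)] leaves [y = f]. *)
Lemma primitive_dress_marks y : primitive_idempotent y ->
  exists2 J, perfect J & J \subset G /\ dress_marks J y.
Proof.
case=> yy y0 y_prim.
have [J [sJG pJ yJ]] : exists J, [/\ J \subset G, perfect J & mark J y = 1].
  apply: contrapT => noJ; apply: y0; apply: idempotent_eq0 => // J sJG pJ.
  by case: (mark_idempotent yy sJG) => // yJ; case: noJ; exists J.
have [f fJ] := dress_marks_exists J; have ff := dress_marks_idempotent fJ.
exists J => //; split=> //; suff <-: f = y by [].
have yf : y * f = f.
  apply: mark_inj => K sKG; rewrite markM // fJ //.
  case: (boolP (conj_subgroups G _ J)) => [KJ|_]; last by rewrite mulr0.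
  by rewrite -(mark_sol_residual yy) // (mark_conj y sJG KJ) yJ mulr1.
have [| | | |f0|/eqP] := y_prim f (y - f) ff; last 2 first.
- have := dress_marks_perfect pJ sJG fJ.
  by rewrite f0 mark0 // conj_subgroups_refl.
- by rewrite subr_eq0 => /eqP.
- by rewrite mulrBl !mulrBr yy ff yf (mulrC f) yf subrr subr0.
- by rewrite mulrBr ff (mulrC f) yf subrr.
- by rewrite mulrBl ff yf subrr.
- by rewrite addrC subrK.
Qed.

Lemma qtens_ext_markD K (x x' : qtens (burnside G)) : K \subset G ->
  qtens_ext (mark K) (x + x') = qtens_ext (mark K) x + qtens_ext (mark K) x'.
Proof.
move=> sKG; have mK := mark_zmod_morphism sKG; rewrite -(qfracK x) -(qfracK x').
set a := qnum x; set n := qden x; set b := qnum x'; set m := qden x'.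
rewrite [_ + _]qaddE !qtens_extE // (zmod_morphismD mK) !(zmod_morphismMn _ mK).
rewrite prednK ?muln_gt0 // rmorphD /= !rmorphMn /= natrM.
by rewrite addf_div ?pnatr_eq0 // !mulr_natr.
Qed.

Lemma qtens_ext_markM K (x x' : qtens (burnside G)) : K \subset G ->
  qtens_ext (mark K) (x * x') = qtens_ext (mark K) x * qtens_ext (mark K) x'.
Proof.
move=> sKG; have mK := mark_zmod_morphism sKG; rewrite -(qfracK x) -(qfracK x').
set a := qnum x; set n := qden x; set b := qnum x'; set m := qden x'.
rewrite [_ * _]qmulE !qtens_extE // markM // prednK ?muln_gt0 // rmorphM /= natrM.
by rewrite mulf_div.
Qed.

Lemma qtens_ext_mark_in K f : K \subset G ->
  qtens_ext (mark K) (qtens_in f) = (mark K f)%:~R.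
Proof.
by move=> sKG; rewrite qtens_extE ?divr1 //; apply: mark_zmod_morphism.
Qed.

Lemma qtens_ext_mark0 K : K \subset G -> qtens_ext (mark K) (0 : qtens (burnside G)) = 0.
Proof. by move=> sKG; rewrite [LHS]qtens_ext_mark_in // mark0. Qed.

Lemma qtens_mark_inj (x x' : qtens (burnside G)) :
  (forall K, K \subset G -> qtens_ext (mark K) x = qtens_ext (mark K) x') -> x = x'.
Proof.
rewrite -(qfracK x) -(qfracK x').
set a := qnum x; set n := qden x; set b := qnum x'; set m := qden x' => exx'.
apply/qfracP; exists 0%N; rewrite mulr1n; apply/eqP; rewrite subr_eq0; apply/eqP.
apply: mark_inj => K sKG; have mK := mark_zmod_morphism sKG.
have := exx' K sKG; rewrite !(qtens_extE _ _ mK) => /intr_div_eq.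
by rewrite !(zmod_morphismMn _ mK).
Qed.

(** Every normalizer order divides [#|G|], so [#|G|] times the indicator function of the class of
    [H] satisfies the congruences term by term and lifts to [B(G)]. *)
Lemma burnside_idem_exists H : H \subset G ->
  exists e : qtens (burnside G), primitive_idempotent e /\
    forall K, K \subset G -> qtens_ext (mark K) e = (conj_subgroups G K H)%:R.
Proof.
move=> sHG.
have [||y yP] := @ghost_lift _ G (fun K => (conj_subgroups G K H)%:R *+ #|G|).
- move=> K g sKG Gg; congr (_%:R *+ _); congr nat_of_bool.
  apply/idP/idP; apply: conj_subgroups_trans; last exact: conj_subgroupsJ.
  by rewrite conj_subgroups_sym conj_subgroupsJ.
- move=> K sKG; apply: rpred_sum => g _.
  by rewrite dvdz_mulrn // cardSg // subsetIl.
(* [qfrac y n] has denominator [n.+1], so this divides [y] by [#|G|]. *)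
pose e := qfrac y #|G|.-1.
have eP K : K \subset G -> qtens_ext (mark K) e = (conj_subgroups G K H)%:R.
  move=> sKG; rewrite qtens_extE ?yP //; last exact: mark_zmod_morphism.
  rewrite rmorphMn /= prednK ?cardG_gt0 // -mulr_natr mulfK ?pnatr_eq0 -?lt0n //.
  by rewrite rmorph_nat.
exists e; split=> //; split=> [|e0|a b aa bb ab _ eab].
- by apply: qtens_mark_inj => K sKG; rewrite qtens_ext_markM // eP // -natrM mulnb andbb.
- by have := eP H sHG; rewrite e0 qtens_ext_mark0 // conj_subgroups_refl.
have markC (c : qtens (burnside G)) K : K \subset G -> conj_subgroups G K H ->
    qtens_ext (mark K) c = qtens_ext (mark H) c.
  by move=> sKG KH; rewrite /qtens_ext (mark_conj _ sHG KH).
suff vanish (c d : qtens (burnside G)) : c * c = c -> d * d = d -> e = c + d ->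
    qtens_ext (mark H) c = 0 -> c = 0.
  have : qtens_ext (mark H) a * qtens_ext (mark H) b = 0.
    by rewrite -qtens_ext_markM // ab qtens_ext_mark0.
  move/eqP; rewrite mulf_eq0 => /orP[]/eqP H0; [left|right].
    exact: vanish aa bb eab H0.
  by apply: vanish bb aa _ H0; rewrite addrC.
move=> cc dd ecd cH; apply: qtens_mark_inj => K sKG; rewrite qtens_ext_mark0 //.
have [KH|nKH] := boolP (conj_subgroups G K H); first by rewrite markC.
have := eP K sKG; rewrite (negPf nKH) ecd qtens_ext_markD //.
have idem (c' : qtens (burnside G)) : c' * c' = c' -> qtens_ext (mark K) c' = 0 \/ qtens_ext (mark K) c' = 1.
  by move=> cc'; apply: idempotent_idomain; rewrite -qtens_ext_markM ?cc'.
by case: (idem c cc) => -> //; case: (idem d dd) => ->.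
Qed.

Lemma burnside_idemE H K : H \subset G -> K \subset G ->
  qtens_ext (mark K) (burnside_idem G H) = (conj_subgroups G K H)%:R.
Proof.
move=> sHG sKG; have [_] := classical_sets.xgetPex 0 (burnside_idem_exists sHG).
exact.
Qed.

Lemma conj_representatives_sub (C D : {set {group gT}}) K :
  conj_representatives G C D -> K \in C -> K \in D.
Proof. by case/and3P=> _ /subsetP/(_ K). Qed.

Lemma conj_representatives_card (C D : {set {group gT}}) K :
  conj_representatives G C D -> K \in D -> #|[set H in C | conj_subgroups G H K]| = 1%N.
Proof.
case/and3P=> _ _ /forall_inP CP DK; have /eqP <- := CP _ (imset_f _ DK).
by apply: eq_card => H; rewrite !inE.
Qed.

(** The defining sum and the element from [dress_marks_exists] have the same rational marks, so the
    choice in [dress_idem] has a candidate and its result has these marks. *)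
Lemma dress_idem_marks (C : {set {group gT}}) J :
  conj_representatives G C (subgroups G) -> dress_marks J (dress_idem G C J).
Proof.
move=> hC.
have sumE K : K \subset G -> qtens_ext (mark K)
    (\sum_(H in C | conj_subgroups G (sol_residual H) J) burnside_idem G H) =
    (conj_subgroups G (sol_residual K) J)%:R.
  move=> sKG.
  have qD : {morph @qtens_ext (burnside G) (mark K) : x x' / x + x'}.
    by move=> x x'; apply: qtens_ext_markD.
  rewrite (big_morph _ qD (qtens_ext_mark0 sKG)).
  (* [C] contains exactly one conjugate [H] of [K]. Only that index contributes at [K], and its
     residual is conjugate to that of [K]. *)
  transitivity ((conj_subgroups G (sol_residual K) J)%:R *
                \sum_(H in [set H in C | conj_subgroups G H K]) 1 : rat); last first.
    by rewrite sumr_const (conj_representatives_card hC) ?inE // mulr1.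
  rewrite mulr_sumr big_mkcondr [LHS]big_mkcond [RHS]big_mkcond /=.
  apply: eq_bigr => H _; rewrite inE; case: (boolP (H \in C)) => //= CH.
  have sHG : H \subset G by have := conj_representatives_sub hC CH; rewrite inE.
  rewrite burnside_idemE // (conj_subgroups_sym _ K) mulr1.
  have [HK|_] := boolP (conj_subgroups G H K); last by case: ifP.
  have HK' := conj_sol_residual HK.
  have -> : conj_subgroups G (sol_residual H) J = conj_subgroups G (sol_residual K) J.
    apply/idP/idP; apply: conj_subgroups_trans => //.
    by rewrite conj_subgroups_sym.
  by case: ifP.
have [f fJ] := dress_marks_exists J.
have := classical_sets.xgetPex 0 (ex_intro (fun f => qtens_in f =
  \sum_(H in C | conj_subgroups G (sol_residual H) J) burnside_idem G H) f _).
move=> xP K sKG; apply: (@intr_inj rat); rewrite -qtens_ext_mark_in //.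
rewrite /dress_idem xP ?sumE ?rmorph_nat //.
by apply: qtens_mark_inj => L sLG; rewrite qtens_ext_mark_in // sumE // fJ // rmorph_nat.
Qed.

End BurnsideIdempotents.

(** [f] and [u] are mutually inverse on idempotents and preserve sums and products, so
    decompositions into orthogonal idempotents correspond. *)
Lemma primitive_idempotent_retract (A B : comPzRingType) (f : A -> B) (u : B -> A) :
  zmod_morphism f -> {morph f : x y / x * y} ->
  zmod_morphism u -> {morph u : x y / x * y} ->
  cancel f u -> (forall x, x * x = x -> f (u x) = x) ->
  forall x, primitive_idempotent x <->
    exists2 y, primitive_idempotent y & x = f y.
Proof.
move=> fB fM uB uM fK uK.
have f0 := zmod_morphism0 fB; have u0 := zmod_morphism0 uB.
have fD := zmod_morphismD fB; have uD := zmod_morphismD uB.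
move=> x; split=> [[xx x0 x_prim]|[y [yy y0 y_prim] ->]].
  exists (u x); last by rewrite uK.
  split=> [|ux0|a b aa bb ab ba uab]; first by rewrite -uM xx.
    by apply: x0; rewrite -(uK x) // ux0.
  have [| | | | |fa0|fb0] := x_prim (f a) (f b).
  - by rewrite -fM aa.
  - by rewrite -fM bb.
  - by rewrite -fM ab.
  - by rewrite -fM ba.
  - by rewrite -fD -uab uK.
  - by left; rewrite -(fK a) fa0.
  - by right; rewrite -(fK b) fb0.
split=> [|fy0|a b aa bb ab ba fyab]; first by rewrite -fM yy.
  by apply: y0; rewrite -(fK y) fy0.
have [| | | | |ua0|ub0] := y_prim (u a) (u b).
- by rewrite -uM aa.
- by rewrite -uM bb.
- by rewrite -uM ab.
- by rewrite -uM ba.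
- by rewrite -uD -fyab fK.
- by left; rewrite -(uK a) // ua0.
- by right; rewrite -(uK b) // ub0.
Qed.

Theorem theorem2p2 (gT : finGroupType) (G : {group gT})
    (C Cinf : {set {group gT}})
    (hC : conj_representatives G C (subgroups G))
    (hCinf : conj_representatives G Cinf [set J in subgroups G | perfect J])
    (x : crossed_burnside G) :
  primitive_idempotent x <->
  exists2 J : {group gT}, J \in Cinf & x = crossed_iota (dress_idem G C J).
Proof.
have retract := primitive_idempotent_retract (@crossed_iota_zmod_morphism gT G)
  (@crossed_iotaM gT G) (@forget_zmod_morphism gT G) (@forgetM gT G)
  (@crossed_iotaK gT G) (@crossed_idempotent_iota gT G).
split=> [/retract[y /primitive_dress_marks[K pK [sKG yK]] ->]|[J CJ ->]].
  (* The perfect subgroup [K] attached to [y] is replaced by its representative in [Cinf], which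
     prescribes the same marks. *)
  have: (0 < #|[set J in Cinf | conj_subgroups G J K]|)%N.
    by rewrite (conj_representatives_card hCinf) // !inE sKG pK.
  rewrite card_gt0 => /set0Pn[J]; rewrite inE => /andP[CJ JK].
  exists J => //; congr crossed_iota.
  apply: dress_marks_inj (dress_idem_marks J hC) => L sLG; rewrite yK //.
  congr (_ _)%:R; apply/idP/idP => /conj_subgroups_trans; apply=> //.
  by rewrite conj_subgroups_sym.
apply/retract; exists (dress_idem G C J) => //.
have := conj_representatives_sub hCinf CJ; rewrite !inE => /andP[sJG pJ].
exact: dress_marks_primitive sJG pJ (dress_idem_marks J hC).
Qed.
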